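(* Let $N\ge 3$. Let $\ell^1$ denote the minimal length on the braid group $B_N$ with respect to the Artin generators, and let $\ell_{\mathrm R}^2$ denote the rational length on $B_N$ with respect to the Birman-Ko-Lee (BKL) Garside structure (the length in BKL generators of the rational normal form in the BKL structure). For each $x\in B_N$: $$\frac1{2N-3}\,\ell^1(x)\le\ell_{\mathrm R}^2(x)\le(N-2)\,\ell^1(x).$$
   Context: Artin structure: $B_N$ is the group generated by $\sigma_1,\dots,\sigma_{N-1}$ subject to $\sigma_i\sigma_{i+1}\sigma_i=\sigma_{i+1}\sigma_i\sigma_{i+1}$ and $\sigma_i\sigma_j=\sigma_j\sigma_i$ when $|i-j|>1$. $\ell^1(x)$ is the minimal length of an expression of $x\in B_N$ as a product of elements of $\{\sigma_1,\dots,\sigma_{N-1}\}^{\pm1}$. BKL structure: $BKL_N^+$ is the monoid generated by $a_{t,s}$, $1\le s<t\le N$, subject to the relations $a_{t,s}a_{r,q}=a_{r,q}a_{t,s}$ if $(t-r)(t-q)(s-r)(s-q)>0$, and $a_{t,s}a_{s,r}=a_{t,r}a_{t,s}=a_{s,r}a_{t,r}$ if $t>s>r$. It is a Garside monoid whose atoms are the $a_{t,s}$, with fundamental element $\delta=a_{N,N-1}a_{N-1,N-2}\cdots a_{2,1}$, and its group of fractions is $B_N$, via $a_{t,s}=(\sigma_{t-1}\cdots\sigma_{s+1})\sigma_s(\sigma_{s+1}^{-1}\cdots\sigma_{t-1}^{-1})$. Write $M=BKL_N^+\subseteq B_N$. For $a,b\in M$, $a$ is a left divisor of $b$ if $ac=b$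 for some $c\in M$, and $a\wedge b$ is the greatest common divisor with respect to left divisibility. Greedy normal form of $x\in M$: put $x_1=x$, $s_i=\delta\wedge x_i$, $x_{i+1}=s_i^{-1}x_i$, and let $n$ be minimal with $x_{n+1}=1$; then $x=s_1\cdots s_n$ (the leading factors may equal $\delta$). For each $x\in B_N$ there is a unique pair $(u,v)\in M\times M$ with $x=u^{-1}v$ and $u\wedge v=1$. If $s_1\cdots s_k$ and $p_1\cdots p_l$ are the greedy normal forms of $u$ and $v$ ($k=0$ or $l=0$ allowed), the rational normal form of $x$ is $(s_1\cdots s_k)^{-1}(p_1\cdots p_l)$, and $\ell_{\mathrm R}^2(x)=\sum_{i=1}^k\ell^2(s_i)+\sum_{j=1}^l\ell^2(p_j)$, where $\ell^2(y)$ is the minimal length of an expression of $y\in B_N$ as a product of elements $a_{t,s}^{\pm1}$. *)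

(* Defs.v *)
From HB Require Import structures.
From mathcomp Require Import all_boot all_order all_algebra.
From mathcomp Require Import boolp classical_sets.

Set Implicit Arguments.
Unset Strict Implicit.
Unset Printing Implicit Defensive.

Import Order.TTheory GRing.Theory Num.Theory.

Local Open Scope group_scope.
Local Open Scope quotient_scope.

Inductive pres_cong (A : Type) (R : seq A -> seq A -> Prop) :
    seq A -> seq A -> Prop :=
| pres_refl s : pres_cong R s s
| pres_sym s t : pres_cong R s t -> pres_cong R t s
| pres_trans s t u : pres_cong R s t -> pres_cong R t u -> pres_cong R s u
| pres_step p q s t : R s t -> pres_cong R (p ++ s ++ q) (p ++ t ++ q).

Section PresentedMonoid.
Variables (A : choiceType) (R : seq A -> seq A -> Prop).

Definition pres_rel : rel (seq A) := fun s t => `[< pres_cong R s t >].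

Fact pres_rel_refl : reflexive pres_rel.
Proof. by move=> s; apply/asboolP; apply: pres_refl. Qed.

Fact pres_rel_sym : symmetric pres_rel.
Proof. by move=> s t; apply/asboolP/asboolP; apply: pres_sym. Qed.

Fact pres_rel_trans : transitive pres_rel.
Proof.
by move=> t s u /asboolP st /asboolP tu; apply/asboolP; apply: pres_trans tu.
Qed.

Canonical pres_equiv := EquivRel pres_rel pres_rel_refl pres_rel_sym
  pres_rel_trans.

Definition presented := {eq_quot pres_equiv}.
HB.instance Definition _ := EqQuotient.on presented.
HB.instance Definition _ := Choice.on presented.

Lemma pres_eqP s t : \pi_presented s = \pi_presented t <-> pres_cong R s t.
Proof. by split=> [/eqmodP/asboolP //|st]; apply/eqmodP/asboolP. Qed.

Lemma pres_reprP s : pres_cong R (repr (\pi_presented s)) s.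
Proof. by apply/pres_eqP; rewrite reprK. Qed.

Lemma pres_cong_cat s s' t t' :
  pres_cong R s s' -> pres_cong R t t' -> pres_cong R (s ++ t) (s' ++ t').
Proof.
move=> ss' tt'; apply: (@pres_trans _ _ _ (s' ++ t)).
  elim: ss' t {t' tt'} => {s s'} [s|s t _ IH|s t u _ IH1 _ IH2|p q s t st] w.
  - exact: pres_refl.
  - exact: pres_sym.
  - exact: pres_trans (IH1 w) (IH2 w).
  - by rewrite -!catA; apply: pres_step.
elim: tt' => {s ss' t t'} [s|s t _ IH|s t u _ IH1 _ IH2|p q s t st].
- exact: pres_refl.
- exact: pres_sym.
- exact: pres_trans IH1 IH2.
- by rewrite !(catA s' p); apply: pres_step.
Qed.

Definition pres_mul (x y : presented) : presented :=
  \pi_presented (repr x ++ repr y).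
Definition pres_one : presented := \pi_presented [::].

Lemma pres_mul_pi s t :
  pres_mul (\pi_presented s) (\pi_presented t) = \pi_presented (s ++ t).
Proof. by apply/pres_eqP/pres_cong_cat; apply: pres_reprP. Qed.

Fact pres_mulA : associative pres_mul.
Proof.
elim/quotW=> x; elim/quotW=> y; elim/quotW=> z.
by rewrite (pres_mul_pi y z) (pres_mul_pi x y) !pres_mul_pi catA.
Qed.

Fact pres_mul1 : left_id pres_one pres_mul.
Proof. by move=> x; rewrite -[x]reprK pres_mul_pi. Qed.

Fact pres_1mul : right_id pres_one pres_mul.
Proof. by move=> x; rewrite -[x]reprK pres_mul_pi cats0. Qed.

HB.instance Definition _ :=
  isMonoid.Build presented pres_mulA pres_mul1 pres_1mul.

Definition pres_gen (a : A) : presented := \pi_presented [:: a].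

Lemma pres_prod_gen s : \prod_(a <- s) pres_gen a = \pi_presented s.
Proof.
elim: s => [|a s IH]; first by rewrite big_nil.
by rewrite big_cons IH [LHS]pres_mul_pi.
Qed.

Lemma pres_rel_prod s t : R s t ->
  \prod_(a <- s) pres_gen a = \prod_(a <- t) pres_gen a.
Proof.
move=> st; rewrite !pres_prod_gen; apply/pres_eqP.
by have := pres_step [::] [::] st; rewrite !cats0.
Qed.

Definition pres_lift (M : monoidType) (f : A -> M) (x : presented) : M :=
  \prod_(a <- repr x) f a.

Lemma pres_lift_pi (M : monoidType) (f : A -> M) s :
  (forall u v, R u v -> \prod_(a <- u) f a = \prod_(a <- v) f a) ->
  pres_lift f (\pi_presented s) = \prod_(a <- s) f a.
Proof.
move=> fR; rewrite /pres_lift; move: (repr _) (pres_reprP s) => t.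
elim=> // [u v w _ -> _ -> //|p q u v uv].
by rewrite !big_cat /= (fR _ _ uv).
Qed.

End PresentedMonoid.

(* The letter [(a, b)] stands for [a] if [b = false], for [a^-1] otherwise. *)
Inductive group_rel (A : Type) (R : seq A -> seq A -> Prop) :
    seq (A * bool) -> seq (A * bool) -> Prop :=
| group_rel_cancel a b : group_rel R [:: (a, b); (a, ~~ b)] [::]
| group_rel_pos s t : R s t ->
    group_rel R [seq (a, false) | a <- s] [seq (a, false) | a <- t].

Section PresentedGroup.
Variables (A : choiceType) (R : seq A -> seq A -> Prop).

Definition presented_group := presented (group_rel R).
HB.instance Definition _ := Monoid.on presented_group.

Definition inv_word (w : seq (A * bool)) :=
  rev [seq (l.1, ~~ l.2) | l <- w].

Lemma inv_word_mulV w : pres_cong (group_rel R) (w ++ inv_word w) [::].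
Proof.
elim: w => [|[a b] w IH]; first exact: pres_refl.
rewrite /inv_word /= rev_cons -cats1 -/(inv_word w).
apply: (@pres_trans _ _ _ ([:: (a, b)] ++ [::] ++ [:: (a, ~~ b)])).
  rewrite -[_ :: _ ++ _]/([:: (a, b)] ++ (w ++ (inv_word w ++ _))) catA.
  rewrite [X in pres_cong _ X _](_ : _ =
    [:: (a, b)] ++ (w ++ inv_word w) ++ [:: (a, ~~ b)]); last by rewrite -!catA.
  apply: pres_cong_cat; first exact: pres_refl.
  by apply: pres_cong_cat => //; apply: pres_refl.
exact: (pres_step [::] [::] (group_rel_cancel R a b)).
Qed.

Lemma inv_wordK : involutive inv_word.
Proof.
move=> w; rewrite /inv_word map_rev revK -map_comp -[RHS]map_id.
by apply: eq_map => -[a b] /=; rewrite negbK.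
Qed.

Definition pres_inv (x : presented_group) : presented_group :=
  \pi_(presented (group_rel R)) (inv_word (repr x)).

Fact pres_mulgV : right_inverse (1 : presented_group) pres_inv *%g.
Proof.
move=> x; rewrite -{1}[x]reprK [LHS]pres_mul_pi.
by apply/pres_eqP; apply: inv_word_mulV.
Qed.

Fact pres_mulVg : left_inverse (1 : presented_group) pres_inv *%g.
Proof.
move=> x; rewrite -{2}[x]reprK [LHS]pres_mul_pi.
by apply/pres_eqP; rewrite -[X in _ ++ X]inv_wordK; apply: inv_word_mulV.
Qed.

HB.instance Definition _ := hasInv.Build presented_group pres_inv.
HB.instance Definition _ :=
  Monoid_isGroup.Build presented_group pres_mulVg pres_mulgV.

Definition group_gen (a : A) : presented_group :=
  pres_gen (group_rel R) (a, false).

Lemma group_rel_prod s t : R s t ->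
  \prod_(a <- s) group_gen a = \prod_(a <- t) group_gen a.
Proof.
move=> st; have := pres_rel_prod (group_rel_pos st).
by rewrite !big_map.
Qed.

End PresentedGroup.

Definition signed_prod (G : groupType) (A : Type) (g : A -> G)
    (w : seq (A * bool)) : G :=
  \prod_(l <- w) (if l.2 then (g l.1)^-1 else g l.1).

Definition min_nat (P : nat -> Prop) : nat :=
  xget 0%N [set n | P n /\ forall m, P m -> (n <= m)%N].

(* The default value of [min_nat] is not used when [g] generates [G]. *)
Definition word_length (G : groupType) (A : Type) (g : A -> G) (x : G) : nat :=
  min_nat (fun n => exists2 w, size w = n & x = signed_prod g w).

Definition artin_idx (N : nat) := {i : nat | (1 <= i < N)%N}.

Inductive artin_rel (N : nat) : seq (artin_idx N) -> seq (artin_idx N) -> Prop :=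
| artin_braid i j : val j = (val i).+1 ->
    artin_rel [:: i; j; i] [:: j; i; j]
| artin_comm i j : (1 < `|((val i)%:Z - (val j)%:Z)%R|)%N ->
    artin_rel [:: i; j] [:: j; i].

Definition braid (N : nat) := presented_group (@artin_rel N).
HB.instance Definition _ N := Group.on (braid N).

Definition artin_gen N (i : artin_idx N) : braid N := group_gen _ i.

Definition ell1 N (x : braid N) : nat := word_length (@artin_gen N) x.

(* Equal to [1] outside the range [1 <= i < N], where it is not used. *)
Definition sigma N (i : nat) : braid N :=
  if insub i is Some j then artin_gen j else 1.

Lemma interleave (t s r q : nat) :
  (0 < (t%:Z - r%:Z) * (t%:Z - q%:Z) * (s%:Z - r%:Z) * (s%:Z - q%:Z))%R ->
  (s < t)%N -> (q < r)%N ->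
  [\/ (r < s)%N, (t < q)%N, (s < q)%N && (r < t)%N | (q < s)%N && (t < r)%N].
Proof.
move=> h st qr.
have [rs|sr|E] := ltngtP r s; last by rewrite E subrr mulr0 mul0r ltxx in h.
  exact: Or41.
have [tq|qt|E] := ltngtP t q; last by rewrite E subrr mulr0 !mul0r ltxx in h.
  exact: Or42.
have c : (s%:Z - r%:Z < 0)%R by rewrite subr_lt0.
have b : (0 < t%:Z - q%:Z)%R by rewrite subr_gt0.
have [sq|qs|E] := ltngtP s q; last by rewrite E subrr mulr0 ltxx in h.
  have d : (s%:Z - q%:Z < 0)%R by rewrite subr_lt0.
  rewrite (nmulr_lgt0 _ d) (nmulr_llt0 _ c) (pmulr_lgt0 _ b) subr_gt0 in h.
  exact: Or43.
have d : (0 < s%:Z - q%:Z)%R by rewrite subr_gt0.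
rewrite (pmulr_lgt0 _ d) (nmulr_lgt0 _ c) (pmulr_llt0 _ b) subr_lt0 in h.
exact: Or44.
Qed.

Section ConjugateRelations.
Variables (G : groupType) (N : nat) (sg : nat -> G) (ba : nat -> nat -> G).
Hypothesis sg_braid : forall i, (1 <= i)%N -> (i.+1 < N)%N ->
  sg i * sg i.+1 * sg i = sg i.+1 * sg i * sg i.+1.
Hypothesis sg_comm : forall i j, (1 <= i)%N -> (i.+1 < j)%N -> (j < N)%N ->
  commute (sg i) (sg j).
Hypothesis baS : forall i, ba i.+1 i = sg i.
Hypothesis ba_rec : forall t s, (s < t)%N -> ba t.+1 s = sg t * ba t s / sg t.

Lemma ba_comm_hi s t k : (1 <= s)%N -> (s < t)%N -> (t < k)%N ->
  (k < N)%N -> commute (ba t s) (sg k).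
Proof.
move=> s1; elim: t => // t IH; rewrite ltnS leq_eqVlt => /orP[/eqP <-|st] tk kN.
  by rewrite baS; apply: sg_comm.
have c : commute (sg k) (sg t).
  by apply/commute_sym/sg_comm => //; apply: leq_trans st.
rewrite ba_rec//; apply: commute_sym.
apply: commuteM; last exact: commuteV.
by apply: commuteM => //; apply/commute_sym/IH => //; apply: ltnW.
Qed.

Lemma ba_comm_lo s t k : (1 <= k)%N -> (k.+1 < s)%N -> (s < t)%N ->
  (t <= N)%N -> commute (ba t s) (sg k).
Proof.
move=> k1 ks; elim: t => // t IH; rewrite ltnS leq_eqVlt => /orP[/eqP <-|st] tN.
  by rewrite baS; apply/commute_sym/sg_comm.
have c : commute (sg k) (sg t) by apply: sg_comm => //; apply: ltn_trans st.
rewrite ba_rec//; apply: commute_sym.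
apply: commuteM; last exact: commuteV.
by apply: commuteM => //; apply/commute_sym/IH => //; apply: ltnW.
Qed.

Lemma ba_comm_mid s t k : (1 <= s)%N -> (s < k)%N -> (k.+1 < t)%N ->
  (t <= N)%N -> commute (ba t s) (sg k).
Proof.
move=> s1 sk; elim: t => // t IH; rewrite ltnS leq_eqVlt => /orP[/eqP <-|kt] tN.
  have k1 : (1 <= k)%N by apply: leq_trans sk.
  rewrite ba_rec; last exact: ltn_trans sk _.
  rewrite ba_rec//.
  have c := ba_comm_hi s1 sk (ltnSn k) tN.
  have b := sg_braid k1 tN.
  rewrite /commute; set a := ba k s in c *; set x := sg k in b *.
  set y := sg k.+1 in b c *.
  have b' : x^-1 * y^-1 * x = y * x^-1 * y^-1.
    apply: (mulIg (y * x)); rewrite -[RHS]mulgA mulKg mulgVK.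
    by rewrite -!mulgA (mulgA x) b -!mulgA !mulKg.
  transitivity (y * x * a * (x^-1 * y^-1 * x)); first by rewrite !mulgA.
  transitivity (x * y * x * a * x^-1 * y^-1); last by rewrite !mulgA.
  by rewrite b' b !mulgA -(mulgA (y * x) a) c !mulgA.
have c : commute (sg k) (sg t).
  by apply: sg_comm => //; apply: leq_trans sk.
rewrite ba_rec; last exact: ltn_trans sk (ltnW kt).
apply: commute_sym; apply: commuteM; last exact: commuteV.
by apply: commuteM => //; apply/commute_sym/IH => //; apply: ltnW.
Qed.

Lemma ba_comm_disj s t q r : (1 <= q)%N -> (q < r)%N -> (r < s)%N ->
  (s < t)%N -> (t <= N)%N -> commute (ba t s) (ba r q).
Proof.
move=> q1; elim: r => // r IH; rewrite ltnS leq_eqVlt => /orP[/eqP <-|qr] rs st tN.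
  by rewrite baS; apply: ba_comm_lo.
have c : commute (ba t s) (sg r).
  by apply: ba_comm_lo => //; apply: leq_trans qr.
rewrite ba_rec//; apply: commuteM; last exact: commuteV.
by apply: commuteM => //; apply: IH => //; apply: ltnW.
Qed.

Lemma ba_comm_nest s t q r : (1 <= s)%N -> (s < q)%N -> (q < r)%N ->
  (r < t)%N -> (t <= N)%N -> commute (ba t s) (ba r q).
Proof.
move=> s1 sq; elim: r => // r IH; rewrite ltnS leq_eqVlt => /orP[/eqP <-|qr] rt tN.
  by rewrite baS; apply: ba_comm_mid.
have c : commute (ba t s) (sg r).
  by apply: ba_comm_mid => //; apply: ltn_trans qr.
rewrite ba_rec//; apply: commuteM; last exact: commuteV.
by apply: commuteM => //; apply: IH => //; apply: ltnW.
Qed.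

Lemma ba_tri1 t s r : (1 <= r)%N -> (r < s)%N -> (s < t)%N -> (t <= N)%N ->
  ba t s * ba s r = ba t r * ba t s.
Proof.
move=> r1 rs; elim: t => // t IH; rewrite ltnS leq_eqVlt => /orP[/eqP <-|st] tN.
  by rewrite baS ba_rec// mulgVK.
have c := ba_comm_hi r1 rs st tN.
rewrite !ba_rec//; last exact: ltn_trans st.
rewrite -!mulgA !mulKg (mulgA (ba t r)) -IH//; last exact: ltnW.
by rewrite -!mulgA (commuteV c).
Qed.

Lemma ba_sigma t r : (1 <= r)%N -> (r < t)%N -> (t < N)%N ->
  sg t * ba t r * sg t = ba t r * sg t * ba t r.
Proof.
move=> r1; elim: t => // t IH; rewrite ltnS leq_eqVlt => /orP[/eqP <-|rt] tN.
  by rewrite baS -sg_braid.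
have c := ba_comm_hi r1 rt (ltnSn t) tN.
have t1 : (1 <= t)%N by apply: leq_trans rt.
have b := sg_braid t1 tN.
have E : ba t.+1 r = (ba t r)^-1 * sg t * ba t r.
  rewrite ba_rec//; apply: (mulIg (sg t)); apply: (mulgI (ba t r)).
  by rewrite mulgVK -!mulgA mulVKg !mulgA IH// ltnW.
rewrite E; set a := ba t r in c *; set x := sg t in b *; set y := sg t.+1 in b c *.
have c' : y * a^-1 = a^-1 * y by apply: commuteV; apply: commute_sym.
transitivity (a^-1 * (y * x * y) * a).
  by rewrite !mulgA c' -!mulgA c.
by rewrite -b -!mulgA (mulgA a y) c -!mulgA mulVKg.
Qed.

Lemma ba_tri2 t s r : (1 <= r)%N -> (r < s)%N -> (s < t)%N -> (t <= N)%N ->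
  ba t s * ba s r = ba s r * ba t r.
Proof.
move=> r1 rs; elim: t => // t IH; rewrite ltnS leq_eqVlt => /orP[/eqP <-|st] tN.
  rewrite baS ba_rec//; apply: (mulIg (sg s)).
  by rewrite ba_sigma// !mulgA mulgVK.
have c := ba_comm_hi r1 rs st tN.
rewrite !ba_rec//; last exact: ltn_trans st.
rewrite -!mulgA -(commuteV c) (mulgA (ba t s)) IH//; last exact: ltnW.
by rewrite !mulgA c.
Qed.

End ConjugateRelations.

(* [(t, s)] indexes the atom a_{t,s}, so the larger index comes first. *)
Definition bkl_idx (N : nat) :=
  {ts : nat * nat | (1 <= ts.2)%N && (ts.2 < ts.1 <= N)%N}.

Inductive bkl_rel (N : nat) : seq (bkl_idx N) -> seq (bkl_idx N) -> Prop :=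
| bkl_comm x y t s r q : val x = (t, s) -> val y = (r, q) ->
    (0 < (t%:Z - r%:Z) * (t%:Z - q%:Z) * (s%:Z - r%:Z) * (s%:Z - q%:Z))%R ->
    bkl_rel [:: x; y] [:: y; x]
| bkl_tri1 x y z t s r : val x = (t, s) -> val y = (s, r) -> val z = (t, r) ->
    bkl_rel [:: x; y] [:: z; x]
| bkl_tri2 x y z t s r : val x = (t, s) -> val y = (s, r) -> val z = (t, r) ->
    bkl_rel [:: z; x] [:: y; z].

Definition bkl (N : nat) := presented (@bkl_rel N).
HB.instance Definition _ N := Monoid.on (bkl N).

(* Equal to [1] outside the range [1 <= s < t <= N], where it is not used. *)
Definition bkl_a N (t s : nat) : bkl N :=
  if insub (t, s) is Some x then pres_gen (@bkl_rel N) x else 1.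

Definition bkl_delta N : bkl N :=
  \prod_(i <- rev (iota 1 N.-1)) bkl_a N i.+1 i.

Definition braid_a N (t s : nat) : braid N :=
  (\prod_(k <- rev (iota s.+1 (t - s.+1))) sigma N k) * sigma N s *
  \prod_(k <- iota s.+1 (t - s.+1)) (sigma N k)^-1.

Definition bkl_gen N (x : bkl_idx N) : braid N :=
  braid_a N (val x).1 (val x).2.

Definition ell2 N (x : braid N) : nat := word_length (@bkl_gen N) x.

Section BKLRelations.
Variable N : nat.
Local Notation sg := (sigma N).
Local Notation ba := (braid_a N).

Let sgE i (h : (1 <= i < N)%N) : sg i = artin_gen (exist _ i h : artin_idx N).
Proof. by rewrite /sigma insubT. Qed.

Lemma sigma_braid i : (1 <= i)%N -> (i.+1 < N)%N ->
  sg i * sg i.+1 * sg i = sg i.+1 * sg i * sg i.+1.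
Proof.
move=> i1 iN; have h1 : (1 <= i < N)%N by rewrite i1 ltnW.
have h2 : (1 <= i.+1 < N)%N by [].
rewrite (sgE h1) (sgE h2) -!mulgA.
have := group_rel_prod (@artin_braid N (exist _ i h1) (exist _ i.+1 h2) erefl).
by rewrite !big_cons !big_nil !mulg1.
Qed.

Lemma sigma_comm i j : (1 <= i)%N -> (i.+1 < j)%N -> (j < N)%N ->
  commute (sg i) (sg j).
Proof.
move=> i1 ij jN.
have h1 : (1 <= i < N)%N by rewrite i1 (ltn_trans _ jN)// (ltn_trans _ ij).
have h2 : (1 <= j < N)%N by rewrite jN (leq_trans _ ij).
rewrite /commute (sgE h1) (sgE h2).
have := group_rel_prod (@artin_comm N (exist _ i h1) (exist _ j h2) _).
rewrite !big_cons !big_nil !mulg1; apply => /=.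
by rewrite distnEr ?(ltnW (ltnW ij))// ltn_subRL addn1.
Qed.

Lemma braid_aS i : ba i.+1 i = sg i.
Proof. by rewrite /braid_a subnn !big_nil mul1g mulg1. Qed.

Lemma braid_a_rec t s : (s < t)%N -> ba t.+1 s = sg t * ba t s / sg t.
Proof.
move=> st; have E : (t.+1 - s.+1 = t - s.+1 + 1)%N by rewrite addn1 subSn.
rewrite /braid_a E iotaD rev_cat !big_cat /=.
by rewrite !big_seq1 subnKC // !mulgA.
Qed.

Let comm_disj := ba_comm_disj sigma_comm braid_aS braid_a_rec.
Let comm_nest := ba_comm_nest sigma_braid sigma_comm braid_aS braid_a_rec.
Let tri1 := ba_tri1 sigma_comm braid_aS braid_a_rec.
Let tri2 := ba_tri2 sigma_braid sigma_comm braid_aS braid_a_rec.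

Lemma bkl_gen_rel u v : bkl_rel u v ->
  \prod_(x <- u) bkl_gen x = \prod_(x <- v) bkl_gen (N := N) x.
Proof.
case=> [x y t s r q xE yE|x y z t s r xE yE zE|x y z t s r xE yE zE];
  rewrite !big_cons !big_nil !mulg1 /bkl_gen ?xE ?yE ?zE /=.
- move: (valP x) (valP y); rewrite xE yE /= => /and3P[s1 st tN] /and3P[q1 qr rN].
  move=> /interleave/(_ st qr)[rs|tq|sq_rt|qs_tr].
  + exact: comm_disj.
  + by apply/commute_sym/comm_disj.
  + by case/andP: sq_rt => sq rt; apply: comm_nest.
  + by case/andP: qs_tr => qs tr; apply/commute_sym/comm_nest.
- move: (valP x) (valP y); rewrite xE yE /= => /and3P[s1 st tN] /and3P[r1 rs _].
  exact: tri1.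
- move: (valP x) (valP y); rewrite xE yE /= => /and3P[s1 st tN] /and3P[r1 rs _].
  by rewrite -tri1// tri2.
Qed.

End BKLRelations.

(* The inclusion of the BKL monoid in its group of fractions B_N; injectivity is
   a theorem and is not assumed. *)
Definition bkl_braid N (x : bkl N) : braid N := pres_lift (@bkl_gen N) x.

Fact bkl_braid_monoid_morphism N :
  (@bkl_braid N 1 = 1) * {morph @bkl_braid N : x y / x * y}.
Proof.
have lift_pi w := @pres_lift_pi _ _ (braid N) _ w (@bkl_gen_rel N).
split; first by rewrite /bkl_braid lift_pi big_nil.
by move=> x y; rewrite [LHS]lift_pi big_cat.
Qed.

HB.instance Definition _ N :=
  isUMagmaMorphism.Build (bkl N) (braid N) (@bkl_braid N)
    (@bkl_braid_monoid_morphism N).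

Lemma bkl_braid_gen N (x : bkl_idx N) :
  bkl_braid (pres_gen (@bkl_rel N) x) = bkl_gen x.
Proof.
rewrite /bkl_braid /pres_gen (pres_lift_pi _ (@bkl_gen_rel N)).
by rewrite big_seq1.
Qed.

Definition ldiv (M : monoidType) (a b : M) : Prop := exists c, a * c = b.

Definition is_lgcd (M : monoidType) (a b d : M) : Prop :=
  [/\ ldiv d a, ldiv d b & forall e, ldiv e a -> ldiv e b -> ldiv e d].

(* [greedy_nf x s] : the greedy normal form of [x] is s_1 ... s_n.  The tail
   s_1^-1 x is the [y] with [s_1 * y = x]; the condition [x <> 1] in the second
   clause makes n minimal. *)
Inductive greedy_nf (N : nat) : bkl N -> seq (bkl N) -> Prop :=
| greedy_nil : greedy_nf 1 [::]
| greedy_cons x s y ss : x <> 1 -> is_lgcd (bkl_delta N) x s -> s * y = x ->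
    greedy_nf y ss -> greedy_nf x (s :: ss).

Definition rational_nf N (x : braid N) (sp : seq (bkl N) * seq (bkl N)) :
    Prop :=
  exists u v : bkl N,
    [/\ x = (bkl_braid u)^-1 * bkl_braid v, is_lgcd u v 1,
        greedy_nf u sp.1 & greedy_nf v sp.2].

(* Every braid has exactly one rational normal form, so the default value of
   [xget] is not used. *)
Definition ell2R N (x : braid N) : nat :=
  let sp := xget ([::], [::]) [set sp | rational_nf x sp] in
  (\sum_(s <- sp.1) ell2 (bkl_braid s) + \sum_(p <- sp.2) ell2 (bkl_braid p))%N.

(* Main.v *)
Require Import Defs.
From mathcomp Require Import all_boot all_order all_algebra.
From mathcomp Require Import boolp classical_sets perm zify.

Set Implicit Arguments.
Unset Strict Implicit.
Unset Printing Implicit Defensive.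
Import Order.TTheory GRing.Theory Num.Theory.
Local Open Scope group_scope.

(** The BKL monoid M is a Garside monoid whose fundamental element delta has
    length N-1 in the atoms, and the rational normal form of x comes from the
    unique reduced fraction u^-1 v. Since M is homogeneous, the rational
    length of x is at most len u + len v.

    Upper bound. Take a shortest Artin word for x. Its letters are atoms and
    inverses of atoms. For q and r dividing delta and different from 1 and
    delta, q r^-1 = (delta q^-1)^-1 (delta r^-1), and the two cofactors again
    divide delta and differ from it. Hence all inverses can be moved to the
    left while each letter stays a proper divisor of delta, of length at most
    N-2; this gives x = u0^-1 v0 with len u0 + len v0 <= (N-2) ell1 x
    ([fraction_bound]). The reduced fraction divides this one
    ([reduced_fraction_ldiv]), so it is not longer.

    Lower bound. An atom is a conjugate of an Artin generator with Artin
    length at most 2N-3; apply this to shortest BKL words of the normal form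
    factors.

    Both need the Garside structure of M: left cancellation, greatest common
    left divisors, and injectivity of the map from M to the braid group. The
    simple elements are modelled by noncrossing permutations of a cyclically
    ordered set, where divisibility is refinement of orbits and meets are
    intersections of orbits ([meet_exists]). Each simple permutation has a
    normal word in M, and this is multiplicative ([simple_mul]). An element x
    of M then has a well-defined greatest simple divisor and tail: left
    multiplication by an atom b replaces a simple head s by b times the meet
    of s with the complement of b, and this respects the relations of M
    ([push_push]). Left cancellation ([gen_inj]) and greatest common divisors
    ([lgcd_exists]) follow. Conjugation by delta is an automorphism of finite
    order ([shift_periodic]), so M has fractions m delta^-k; the braid group
    acts on them by left multiplication, which gives injectivity
    ([bkl_braid_inj]). *)

(** * Noncrossing permutations *)

(** Whether y is met strictly between x and z when going up cyclically from x.
    For z = x the gap is everything except x, so that the gap that a fixed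
    point of a permutation opens contains all the other points. *)
Definition gap (x z y : nat) : bool :=
  [|| (x < y) && (y < z), (z <= x) && (x < y) | (y < z) && (z <= x)].

Section Noncrossing.
Variable n : nat.
Implicit Types r s t k l m u : {perm 'I_n.+1}.
Implicit Types x y z w i j : 'I_n.+1.

(** For a noncrossing s this says that the orbits of t refine those of s
    ([orbit_refines], [refines_orbit]), and it is left divisibility of simple
    elements. Stated with gaps, it turns the comparison of several
    permutations into a statement about the cyclic order of few points. *)
Definition refines t s := forall x y, gap x (s x) y -> gap x (s x) (t y).

(** If s preserves the gap from x to s x, then no point of the cycle of x lies
    in that gap, so cycles run upwards, and a cycle that meets the gap stays
    in it, so cycles do not cross. These permutations are the simple
    elements. *)
Definition noncrossing s := refines s s.

(** An injective map of a finite set into itself is onto. *)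
Lemma refinesE t s : refines t s ->
  forall x y, gap x (s x) (t y) = gap x (s x) y.
Proof.
move=> ts x; pose A := [set y : 'I_n.+1 | gap x (s x) y].
have sub : t @: A \subset A.
  by apply/fintype.subsetP => _ /imsetP[y + ->]; rewrite !inE; apply: ts.
have eA : t @: A = A.
  by apply/eqP; rewrite eqEcard sub (card_imset _ (@perm_inj _ t)) leqnn.
move=> y; apply/idP/idP => [|/ts//].
have AE (v : 'I_n.+1) : gap x (s x) v = (v \in A) by rewrite inE.
by rewrite !AE -{1}eA (mem_imset _ _ (@perm_inj _ t)).
Qed.

Lemma refines1 s : refines 1 s.
Proof. by move=> x y; rewrite perm1. Qed.

Lemma refines_image t s x : refines t s -> ~~ gap x (s x) (t x).
Proof. by move=> /refinesE->; rewrite /gap; lia. Qed.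

Lemma refines_anti t s : refines t s -> refines s t -> s = t.
Proof.
move=> ts st; apply/permP => x; apply: val_inj => /=.
by have := refines_image x ts; have := refines_image x st; rewrite /gap; lia.
Qed.

(** Left division by a common divisor is monotone. Suppose that r w lies in
    the gap from r x to s x but t w does not. Then w lies on the way from r x
    up to x, and t w on the way from x up to r x, so the gap of t at w
    contains x but not r x, although r preserves the gaps of t. *)
Lemma refines_quotient r t s : noncrossing r ->
  refines r t -> refines r s -> refines t s ->
  refines (r^-1 * t) (r^-1 * s).
Proof.
move=> rr rt rs ts y z; rewrite -(permKV r y) -(permKV r z).
move: (r^-1 y) (r^-1 z) => x w; rewrite !permM !permK => h.
have E1 := refinesE ts x w; have E2 := refinesE rs x w.
have E3 := refinesE rr x w; have E4 := refinesE rt w x.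
have E5 := refines_image x rs.
(* Both w and t w lie before s x, hence in the larger gap from r x to s x. *)
have [wx|wx] := boolP (gap x (s x) w).
  rewrite wx in E1 E2; move: E1 E5; clear; rewrite /gap; lia.
have xw : (x : nat) <> w.
  by move=> /val_inj xw; move: h; rewrite xw /gap; clear; lia.
have wr : ~~ gap x (r x) w.
  move: E2 E3 h wx; clear; rewrite /gap; lia.
apply/negPn/negP => tw.
have twx : gap w (t w) x.
  rewrite (negPf wx) in E1; move: tw E1 E5 wr xw; clear; rewrite /gap; lia.
rewrite twx in E4; rewrite (negPf wx) in E1.
by move: tw E1 E4 E5 wr xw; clear; rewrite /gap; lia.
Qed.

(** The cycle 0 -> 1 -> ... -> k-1 -> 0, in the factorization that mirrors the
    factors of delta. *)
Fixpoint partial_cycle (k : nat) : {perm 'I_n.+1} :=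
  if k is k'.+1 then tperm (inord k') (inord k'.-1) * partial_cycle k' else 1.

Lemma val_inord (k : nat) : (k <= n)%N -> (inord k : 'I_n.+1) = k :> nat.
Proof. by move=> kn; rewrite inordK. Qed.

Lemma partial_cycleE (k : nat) x : (k <= n.+1)%N ->
  partial_cycle k x =
    (if (x.+1 < k)%N then x.+1 else if x.+1 == k then 0%N else x) :> nat.
Proof.
elim: k x => [|k IH] x kn; first by rewrite perm1.
have Ik := val_inord kn; have Ik1 : (inord k.-1 : 'I_n.+1) = k.-1 :> nat.
  by rewrite val_inord //; lia.
rewrite /= permM IH; last by lia.
case: tpermP => [->|->|].
- rewrite Ik1 Ik; do !case: ifP; lia.
- rewrite Ik1 Ik; do !case: ifP; lia.
move=> /eqP + /eqP; rewrite -!val_eqE /= Ik Ik1; do !case: ifP; lia.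
Qed.

Definition long_cycle := locked (partial_cycle n.+1).

Lemma long_cycleE x : long_cycle x = (if (x < n)%N then x.+1 else 0%N) :> nat.
Proof.
rewrite /long_cycle -lock partial_cycleE // ltnS; have := ltn_ord x.
by do !case: ifP; lia.
Qed.

(** All gaps of the long cycle are empty. *)
Lemma refines_cycle t : refines t long_cycle.
Proof.
by move=> x y; rewrite long_cycleE /gap; have := ltn_ord y; case: ifP; lia.
Qed.

Lemma noncrossing1 : noncrossing 1. Proof. exact: refines1. Qed.

Lemma noncrossing_cycle : noncrossing long_cycle.
Proof. exact: refines_cycle. Qed.

(** * Kreweras complements *)

(** The Kreweras complement: s times its complement is the long cycle. *)
Definition complement s := s^-1 * long_cycle.

Lemma noncrossing_quotient r s : noncrossing r -> noncrossing s ->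
  refines r s -> noncrossing (r^-1 * s).
Proof. by move=> rr ss rs; apply: refines_quotient. Qed.

Lemma noncrossing_complement s : noncrossing s -> noncrossing (complement s).
Proof.
by move=> ss; apply: noncrossing_quotient => //; apply: refines_cycle.
Qed.

Definition gapr (x z y : nat) := gap x z y || (y == z).

(** The complement of r sends r x to the successor of x, so its gap at r x is
    exactly what the half-open arc from x up to r x leaves out. *)
Lemma gapr_complement r x y : gapr x (r x) y = ~~ gap (r x) (long_cycle x) y.
Proof.
rewrite /gapr long_cycleE /gap; have := ltn_ord y; have := ltn_ord (r x).
have := ltn_ord x; case: ifP; lia.
Qed.

Lemma complementE r x : complement r (r x) = long_cycle x.
Proof. by rewrite permM permK. Qed.

Lemma refines_complement k r x y : refines k (complement r) ->
  gapr x (r x) (k y) = gapr x (r x) y.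
Proof.
by move=> kr; rewrite !gapr_complement -(complementE r x) (refinesE kr).
Qed.

(** A converse of [refines_quotient]: left multiplication by r is monotone on
    the divisors of the complement of r. Both k and l preserve every arc from
    x up to r x. If w lies before l (r x) but r w does not, then the arc from
    w to r w contains l (r x) without containing r x, against l preserving
    it. *)
Lemma refines_mul r k l : noncrossing r -> refines k l ->
  refines k (complement r) -> refines l (complement r) ->
  refines (r * k) (r * l).
Proof.
move=> rr kl kr lr x w; rewrite !permM => h.
have E1 : gapr x (r x) (l (r x)).
  by rewrite (refines_complement _ _ lr) /gapr eqxx orbT.
have E2 := refinesE rr x w; have E3 := refines_complement x (r w) kr.
have E4 := refinesE kl (r x) (r w).
have E5 : gap x (r x) (r w).
  by rewrite E2; move: h E1; clear; rewrite /gapr /gap; lia.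
have [rw|rw] := boolP (gap x (l (r x)) (r w)).
  move: E1 E3 E4 E5 rw; clear; rewrite /gapr /gap; lia.
have E6 : gapr w (r w) (l (r x)).
  by move: h rw E1 E5; clear; rewrite /gapr /gap; lia.
rewrite (refines_complement _ _ lr) in E6; exfalso.
by move: h rw E1 E5 E6; clear; rewrite /gapr /gap; lia.
Qed.

(** * Orbits and meets *)

Lemma orbit_closed s x (P : pred 'I_n.+1) y : (forall v, P v -> P (s v)) ->
  y \in porbit s x -> P x -> P y.
Proof.
move=> Ps /porbitP[i ->] Px.
by elim: i => [|i IH]; rewrite ?expg0 ?perm1 // expgSr permM; apply: Ps.
Qed.

Lemma orbit_gap s x y z : noncrossing s -> z \in porbit s y ->
  gap x (s x) y -> gap x (s x) z.
Proof.
move=> ss zy; apply: (orbit_closed (P := fun v => gap x (s x) v) _ zy) => v.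
exact: ss.
Qed.

Lemma orbit_refines t s : noncrossing s ->
  (forall y, t y \in porbit s y) -> refines t s.
Proof. by move=> ss ts x y; apply: orbit_gap. Qed.

Lemma orbit_trans s x y z :
  y \in porbit s x -> z \in porbit s y -> z \in porbit s x.
Proof. by rewrite -!eq_porbit_mem => /eqP-> /eqP->. Qed.

(** The number of steps up from x to y, where x itself is a full turn away, so
    that a minimizer over a class is the first return to it. *)
Definition dist (x y : nat) : nat :=
  if (x < y)%N then (y - x)%N else (n.+1 + y - x)%N.

Lemma gap_dist x y z : gap x z y = (dist x y < dist x z)%N.
Proof.
rewrite /dist /gap; have := ltn_ord x; have := ltn_ord y; have := ltn_ord z.
do !case: ifP; lia.
Qed.

(** Were t y outside the s-orbit of y, it would lie in the gap of s at the
    last point x of that orbit before t y. As t preserves that gap, y lies in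
    it, and so does the whole orbit of y, including x: absurd. *)
Lemma refines_orbit t s y : noncrossing s -> refines t s -> t y \in porbit s y.
Proof.
move=> ss ts; apply/negPn/negP => tyN; set z := t y in tyN.
case: (@arg_minnP _ y (mem (porbit s y)) (fun x => dist x z) (porbit_id s y)).
move=> x xy xmin.
have sxy : s x \in porbit s y.
  by apply: orbit_trans xy _; apply: (mem_porbit s 1).
have := xmin _ sxy; have zx : z != x by apply: contraNneq tyN => ->.
have zsx : z != s x by apply: contraNneq tyN => ->.
move=> hx; have : gap x (s x) z.
  move: hx zx zsx; rewrite -!val_eqE /dist /gap /=.
  have := ltn_ord x; have := ltn_ord (s x); have := ltn_ord z; do !case: ifP;
    lia.
rewrite (refinesE ts) => /(orbit_gap ss xy); rewrite /gap; clear; lia.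
Qed.

(** The orbit of y could leave the arc from x to z only in a jump over z. The
    gap of that jump would contain z, hence x in the same orbit as z; but it
    does not reach as far as x. *)
Lemma orbit_noncross s x z y y' : noncrossing s -> z \in porbit s x ->
  y \notin porbit s x -> y' \in porbit s y -> gap x z y -> gap x z y'.
Proof.
move=> ss zx yx y'y h.
pose P (v : 'I_n.+1) := gap x z v && (v \notin porbit s x).
suff : P y' by case/andP.
apply: (orbit_closed (P := P) _ y'y); last by rewrite /P h yx.
move=> v /andP[hv vx]; rewrite /P.
have svv : s v \in porbit s v by apply: (mem_porbit s 1).
have svx : s v \notin porbit s x.
  by apply: contra vx => svx; apply: (orbit_trans svx); rewrite porbit_sym.
rewrite svx andbT; apply/negPn/negP => hsv.
have svx' : s v != x by apply: contraNneq svx => ->; apply: porbit_id.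
have svz : s v != z by apply: contraNneq svx => ->.
have zv : gap v (s v) z.
  move: svx' svz hsv hv; rewrite -!val_eqE /= /gap; clear; lia.
have xz : x \in porbit s z by rewrite porbit_sym.
have := orbit_gap ss xz zv.
by move: svx' svz hsv hv; rewrite -!val_eqE /= /gap; clear; lia.
Qed.

Definition is_meet s r m :=
  [/\ noncrossing m, refines m s, refines m r &
      forall u, refines u s -> refines u r -> refines u m].

(** The classes of the meet are the intersections of an orbit of s with an
    orbit of r; the meet sends each point to the next one of its class. *)
Lemma meet_exists s r : noncrossing s -> noncrossing r ->
  exists m, is_meet s r m.
Proof.
move=> ss rr; pose E x := [pred y | (y \in porbit s x) && (y \in porbit r x)].
have Exx x : E x x by apply/andP; split; apply: porbit_id.
have Esym x y : E x y -> E y x.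
  move=> /andP[a b]; apply/andP; split.
    by rewrite (porbit_sym s x y).
  by rewrite (porbit_sym r x y).
have Etr x y z : E x y -> E y z -> E x z.
  move=> /andP[a b] /andP[a' b']; apply/andP; split.
    exact: (orbit_trans a a').
  exact: (orbit_trans b b').
pose f x := arg_min x (E x) (fun y => dist x y).
have fE x : E x (f x) /\ forall y, E x y -> ~~ gap x (f x) y.
  rewrite /f; case: (@arg_minnP _ x (E x) (fun y => dist x y) (Exx x)) =>
    y xy ymin.
  by split => // v /ymin; rewrite gap_dist -leqNgt.
have Enc x y y' z : E x z -> E y y' -> gap x z y -> ~~ E x y -> gap x z y'.
  move=> /andP[zs zr] /andP[ys yr] h; rewrite negb_and => /orP[N|N].
    exact: (orbit_noncross ss zs N ys h).
  exact: (orbit_noncross rr zr N yr h).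
have finj : injective f.
  move=> x y fxy; have [Ex mx] := fE x; have [Ey my] := fE y.
  rewrite fxy in Ex mx; have Exy : E x y by apply: Etr Ex (Esym _ _ Ey).
  apply: val_inj => /=; have := mx _ Exy; have := my _ (Esym _ _ Exy).
  by rewrite /gap; clear; lia.
pose m := perm finj.
have mE u : (forall y, E y (u y)) -> refines u m.
  move=> uE x y; rewrite /m permE => h; have [Ex mx] := fE x.
  apply: (Enc _ y) => //; apply/negP => /mx; by rewrite h.
exists m; split.
- by apply: mE => y; rewrite permE; case: (fE y).
- by apply: orbit_refines => // y; rewrite permE; case: (fE y) => /andP[].
- by apply: orbit_refines => // y; rewrite permE; case: (fE y) => /andP[].
- move=> u us ur; apply: mE => y.
  by apply/andP; split; apply: refines_orbit.
Qed.

Definition meet s r := xget 1 [set m | is_meet s r m]%classic.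

Lemma meetP s r : noncrossing s -> noncrossing r -> is_meet s r (meet s r).
Proof.
move=> ss rr; have [m hm] := meet_exists ss rr.
by rewrite /meet; apply: (@xgetPex _ _ [set m | is_meet s r m]%classic);
  exists m.
Qed.

Lemma tperm_refines i j s :
  (forall x, gap x (s x) i = gap x (s x) j) -> refines (tperm i j) s.
Proof. by move=> h x y; case: tpermP => [->|->|//]; rewrite h. Qed.

Lemma refines_tperm i j s : refines (tperm i j) s ->
  forall x, gap x (s x) i = gap x (s x) j.
Proof. by move=> h x; rewrite -(refinesE h _ j) tpermR. Qed.

Lemma noncrossing_tperm i j : noncrossing (tperm i j).
Proof.
apply: tperm_refines => x; case: tpermP => [->|->|].
- rewrite /gap; lia.
- rewrite /gap; lia.
by move=> /eqP + /eqP; rewrite -!val_eqE /gap /=; lia.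
Qed.

Lemma refines_trans t s r : noncrossing s -> noncrossing r ->
  refines t s -> refines s r -> refines t r.
Proof.
move=> ss rr ts sr; apply: orbit_refines => // y.
have : t y \in porbit s y by apply: refines_orbit.
move=> /(orbit_closed (P := mem (porbit r y))); apply; last exact: porbit_id.
by move=> v /= vy; apply: orbit_trans vy _; apply: refines_orbit.
Qed.

Lemma tperm_image_refines s x : noncrossing s -> refines (tperm x (s x)) s.
Proof.
move=> ss; apply: tperm_refines => y; by rewrite (refinesE ss).
Qed.
End Noncrossing.

(** * Simple elements of the BKL monoid *)

Lemma bkl_aE N (x : bkl_idx N) :
  bkl_a N (val x).1 (val x).2 = pres_gen (@bkl_rel N) x.
Proof. by rewrite /bkl_a -surjective_pairing valK. Qed.

Lemma bkl_a_triangle N t s r : (1 <= r)%N -> (r < s)%N -> (s < t)%N ->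
  (t <= N)%N ->
  bkl_a N t s * bkl_a N s r = bkl_a N t r * bkl_a N t s /\
  bkl_a N t r * bkl_a N t s = bkl_a N s r * bkl_a N t r.
Proof.
move=> r1 rs st tN.
have hx : (1 <= (t, s).2)%N && ((t, s).2 < (t, s).1 <= N)%N by rewrite /=; lia.
have hy : (1 <= (s, r).2)%N && ((s, r).2 < (s, r).1 <= N)%N by rewrite /=; lia.
have hz : (1 <= (t, r).2)%N && ((t, r).2 < (t, r).1 <= N)%N by rewrite /=; lia.
pose x : bkl_idx N := exist _ (t, s) hx.
pose y : bkl_idx N := exist _ (s, r) hy.
pose z : bkl_idx N := exist _ (t, r) hz.
have := pres_rel_prod (@bkl_tri1 N x y z t s r erefl erefl erefl).
have := pres_rel_prod (@bkl_tri2 N x y z t s r erefl erefl erefl).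
by rewrite !big_cons !big_nil !mulg1 -!bkl_aE /= => -> ->.
Qed.

Lemma bkl_a_comm N t s r q : (1 <= s < t)%N -> (t <= N)%N ->
  (1 <= q < r)%N -> (r <= N)%N ->
  [|| (r < s), (t < q), (s < q) && (r < t) | (q < s) && (t < r)]%N ->
  bkl_a N t s * bkl_a N r q = bkl_a N r q * bkl_a N t s.
Proof.
move=> st tN qr rN h.
have hx : (1 <= (t, s).2)%N && ((t, s).2 < (t, s).1 <= N)%N by rewrite /=; lia.
have hy : (1 <= (r, q).2)%N && ((r, q).2 < (r, q).1 <= N)%N by rewrite /=; lia.
pose x : bkl_idx N := exist _ (t, s) hx.
pose y : bkl_idx N := exist _ (r, q) hy.
have := pres_rel_prod (@bkl_comm N x y t s r q erefl erefl _).
rewrite !big_cons !big_nil !mulg1 -!bkl_aE /=; apply.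
rewrite -mulrA; set A := (X in (0 < X * _)%R); set B := (X in (0 < _ * X)%R).
suff [[? ?]|[? ?]] : ((0 < A) /\ (0 < B) \/ (A < 0) /\ (B < 0))%R.
- exact: mulr_gt0.
- by rewrite nmulr_rgt0.
by case/or4P: h => [h|h|h|h]; rewrite /A /B; nia.
Qed.

Section Simple.
Variable n : nat.
Local Notation M := (bkl n.+1).
Implicit Types r s t : {perm 'I_n.+1}.
Implicit Types x y z w i j p : 'I_n.+1.

(** [atom i i] is 1, because [bkl_a] is 1 outside its range; a fixed point
    then contributes a trivial letter in [peel]. *)
Definition atom i j : M := bkl_a n.+1 (maxn i j).+1 (minn i j).+1.

Lemma atomC i j : atom i j = atom j i.
Proof. by rewrite /atom maxnC minnC. Qed.

Lemma atomxx i : atom i i = 1.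
Proof.
by rewrite /atom maxnn minnn /bkl_a insubN //= ltnn.
Qed.

Lemma atom_lt i j : (i < j)%N -> atom i j = bkl_a n.+1 j.+1 i.+1.
Proof. by move=> ij; rewrite /atom (maxn_idPr _) ?(minn_idPl _) // ltnW. Qed.

Lemma atom_triangle i j p : (i < j)%N -> (j < p)%N ->
  atom j p * atom i j = atom i p * atom j p /\
  atom i p * atom j p = atom i j * atom i p.
Proof.
move=> ij jp; rewrite (atom_lt ij) (atom_lt jp) (atom_lt (ltn_trans ij jp)).
by apply: bkl_a_triangle => //; apply: ltn_ord.
Qed.

Lemma atom_commute i j p x : (i < j)%N -> (p < x)%N ->
  [|| (j < p), (x < i), (i < p) && (x < j) | (p < i) && (j < x)]%N ->
  atom i j * atom p x = atom p x * atom i j.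
Proof.
move=> ij px h; rewrite !atom_lt //; apply: bkl_a_comm => //; lia.
Qed.

Lemma tperm_swap s i j : s * tperm i j = tperm (s^-1 i) (s^-1 j) * s.
Proof. by rewrite conjgCV tpermJ. Qed.

(** The normal word of a simple element. On the cycle of the largest point x
    the predecessor of x is p, and the letter of the pair p, x splits off on
    the left; the remaining permutation fixes x. So the letters come by
    decreasing larger index, and delta is the word of the long cycle. *)
Fixpoint peel (k : nat) s : M :=
  if k is k'.+1 then
    let x := inord k' in let p := s^-1 x in
    atom p x * peel k' (tperm x p * s)
  else 1.

Definition fixes_from (k : nat) s := forall x, (k <= x)%N -> s x = x.

Lemma peel_step k s (x := inord k : 'I_n.+1) (p := s^-1 x) :
  (k <= n)%N -> noncrossing s -> fixes_from k.+1 s ->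
  [/\ noncrossing (tperm x p * s), fixes_from k (tperm x p * s) & (p <= x)%N].
Proof.
move=> kn ss sf; have xk : x = k :> nat by apply: val_inord.
have sp : s p = x by rewrite permKV.
have px : (p <= x)%N.
  rewrite leqNgt; apply/negP => xp; have := sf p; rewrite sp -xk => /(_ xp) e.
  by rewrite e ltnn in xp.
split => //.
  rewrite tpermC -[tperm p x]tpermV -sp; apply: noncrossing_quotient => //.
    exact: noncrossing_tperm.
  exact: tperm_image_refines.
move=> y; rewrite leq_eqVlt permM => /orP[/eqP ky|ky].
  have -> : y = x by apply: val_inj; rewrite /= -ky xk.
  by rewrite tpermL sp.
rewrite tpermD ?sf // -val_eqE /= ?xk; first lia.
by move: px; rewrite xk; lia.
Qed.

(** The normal word can be changed to start with any transposition (i j) that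
    divides s. Let x be the largest point and p its predecessor. If the pairs
    i, j and p, x are disjoint they do not cross, so their letters commute; if
    they share a point, a triangle relation moves the letter of i, j past that
    of p, x, and the induction applies to what remains. *)
Lemma atom_peel k s i j :
  (k <= n.+1)%N -> noncrossing s -> fixes_from k s -> i != j ->
  refines (tperm i j) s -> atom i j * peel k (tperm i j * s) = peel k s.
Proof.
elim: k s i j => [|k IH] s i j.
  move=> _ ss sf ij /refines_tperm h; have := h i.
  rewrite (sf i) //; move: ij; rewrite -val_eqE /gap /=; clear; lia.
wlog ij : i j / (i < j)%N.
  move=> H kn ss sf ij; have [h|h|/val_inj h] := ltngtP i j.
  - exact: H.
  - by rewrite tpermC atomC; apply: H => //; rewrite eq_sym.
  - by rewrite h eqxx in ij.
move=> kn ss sf ijN ref_ij.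
have kn' : (k <= n)%N by [].
have := peel_step kn' ss sf; rewrite /=.
set x : 'I_n.+1 := inord k; set p := s^-1 x; move=> [s's' s'f px].
have xk : x = k :> nat by apply: val_inord.
have sp : s p = x by rewrite permKV.
have h := refines_tperm ref_ij.
have jx : (j <= x)%N.
  rewrite leqNgt xk; apply/negP => kj; have := h j.
  rewrite (sf j) //; move: ij; rewrite /gap; clear; lia.
have s'x : (tperm x p * s) x = x by rewrite permM tpermL sp.
have s'p : (tperm x p * s) p = s x by rewrite permM tpermR.
have s'D y : y != x -> y != p -> (tperm x p * s) y = s y.
  by move=> yx yp; rewrite permM tpermD // eq_sym.
have hx := h x; have hp := h p; rewrite sp in hp.
have ssx y : gap x (s x) y = gap x (s x) (s y) by rewrite (refinesE ss).
have refines_rest (a b : 'I_n.+1) :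
    (forall y, y != x -> y != p -> gap y (s y) a = gap y (s y) b) ->
    a != x -> b != x -> gap p (s x) a = gap p (s x) b ->
    refines (tperm a b) (tperm x p * s).
  move=> hab ax bx hpab; apply: tperm_refines => y.
  have [->|yx] := eqVneq y x.
    rewrite s'x; move: ax bx; rewrite -!val_eqE /gap /=; clear; lia.
  have [->|yp] := eqVneq y p; first by rewrite s'p.
  by rewrite s'D // hab.
(* The pair i, j contains the largest point. *)
have [jx'|jxN] := eqVneq j x.
  have [ip|ip] := eqVneq i p.
    rewrite jx' ip tpermC.
    have -> : (tperm x p * s)^-1 x = x.
      by apply: (@perm_inj _ (tperm x p * s)); rewrite permKV s'x.
    by rewrite atomxx mul1g tperm1 mul1g.
  have ip' : (i < p)%N.
    move: ip hp ij; rewrite jx' -val_eqE /gap /=; clear; lia.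
  have px' : (p < x)%N.
    rewrite ltn_neqAle px andbT; apply: contra_neq ip => /val_inj e.
    move: (hx) ij ijN; rewrite -{2}sp e; have := hp; rewrite e jx'.
    move=> h1 _ ix; move: h1 ix; rewrite /gap; clear; lia.
  have -> : (tperm i j * s)^-1 x = p.
    rewrite invgM tpermV permM -/p tpermD // jx' -val_eqE /=; lia.
  rewrite jx'.
  have e : tperm x p * (tperm i x * s) = tperm i p * (tperm x p * s).
    rewrite !mulgA tperm_swap tpermV tpermL tpermD // -val_eqE /=; lia.
  rewrite e mulgA; have [<- _] := atom_triangle ip' px'.
  rewrite -mulgA; congr (_ * _).
  apply: IH => //; first lia.
  apply: refines_rest => //; try by rewrite -val_eqE /=; lia.
    by move=> y yx yp; rewrite h jx' -{1}sp (refinesE ss).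
  by move: hx ip' px'; rewrite jx' /gap; clear; lia.
have jx'' : (j < x)%N by rewrite ltn_neqAle jx andbT val_eqE.
have ix : i != x by rewrite -val_eqE /=; lia.
have pi : p != i.
  apply/eqP => pi; move: hp ij jx''; rewrite pi /gap; clear; lia.
have s1x : (tperm i j * s)^-1 x = tperm i j p by rewrite invgM tpermV permM.
(* The pairs meet at p = j; p = i is excluded, as x directly follows p. *)
rewrite s1x; have [pj|pj] := eqVneq p j.
  have e : tperm x i * (tperm i j * s) = tperm i j * (tperm x p * s).
    rewrite !mulgA pj (conjgC (tperm x i)) tpermJ tpermL tpermD // -val_eqE
      /=; lia.
  have -> : tperm i j p = i by rewrite pj tpermR.
  have [E1 E2] := atom_triangle ij jx''.
  have -> : atom p x = atom j x by rewrite pj.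
  rewrite e mulgA -E2 -E1 -mulgA; congr (_ * _).
  apply: IH => //; first lia.
  apply: refines_rest => //.
  by move: hx (ssx p) ij jx''; rewrite sp pj /gap; clear; lia.
(* The pairs are disjoint: i and j lie in the same gap, so they do not cross. *)
rewrite tpermD // 1?eq_sym //.
have e : tperm x p * (tperm i j * s) = tperm i j * (tperm x p * s).
  rewrite !mulgA tperm_swap tpermV !tpermD // eq_sym //.
rewrite e mulgA.
have -> : atom i j * atom p x = atom p x * atom i j.
  have [->|px'] := eqVneq p x; first by rewrite atomxx mulg1 mul1g.
  apply: atom_commute => //; first by rewrite ltn_neqAle px andbT val_eqE.
  by move: pi pj px' hp ij jx''; rewrite -!val_eqE /gap /=; clear; lia.
rewrite -mulgA; congr (_ * _).
apply: IH => //; first lia.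
apply: refines_rest => //.
have [->|px'] := eqVneq p x; first exact: hx.
by move: pi pj px' hp hx ix jxN px; rewrite -!val_eqE /gap /=; clear; lia.
Qed.

(** Locked, so that rewriting with associativity does not unfold the word. *)
Definition simple := locked (peel n.+1).
Definition delta : M := bkl_delta n.+1.

Lemma atom_simple i j s : noncrossing s -> i != j -> refines (tperm i j) s ->
  atom i j * simple (tperm i j * s) = simple s.
Proof.
rewrite /simple -lock => ss; apply: atom_peel => // x.
by have := ltn_ord x; lia.
Qed.

Lemma peel1 k : peel k 1 = 1.
Proof.
by elim: k => //= k IH; rewrite invg1 perm1 atomxx tperm1 !mul1g IH.
Qed.

Lemma simple1 : simple 1 = 1. Proof. by rewrite /simple -lock peel1. Qed.

Lemma simple_tperm i j : simple (tperm i j) = atom i j.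
Proof.
have [->|ij] := eqVneq i j; first by rewrite tperm1 simple1 atomxx.
rewrite -(@atom_simple i j) //; last exact: noncrossing_tperm.
  by rewrite tperm2 simple1 mulg1.
exact: noncrossing_tperm.
Qed.

Lemma simple_delta : simple (long_cycle n) = delta.
Proof.
rewrite /simple /long_cycle -!lock /delta /bkl_delta.
have H k : (k <= n)%N -> peel k.+1 (partial_cycle n k.+1) =
    \prod_(i <- rev (iota 1 k)) bkl_a n.+1 i.+1 i.
  elim: k => [|k IH] kn.
    rewrite big_nil /= tperm1 mul1g invg1 perm1 atomxx mul1g //.
  pose u : 'I_n.+1 := inord k.+1; set g := partial_cycle n k.+2.
  have -> : peel k.+2 g = atom (g^-1 u) u * peel k.+1 (tperm u (g^-1 u) * g).
    by [].
  have uk : u = k.+1 :> nat by apply: val_inord.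
  have kk : (inord k : 'I_n.+1) = k :> nat by apply: val_inord; lia.
  have -> : g^-1 u = inord k.
    apply: (@perm_inj _ g); rewrite permKV; apply: ord_inj.
    by rewrite partial_cycleE // kk ltnSn uk.
  have -> : tperm u (inord k) * g = partial_cycle n k.+1.
    by rewrite -[RHS]mul1g -(tperm2 u (inord k)) -mulgA.
  rewrite IH; last lia.
  have -> : iota 1 k.+1 = iota 1 k ++ [:: k.+1].
    by rewrite -[X in iota 1 X]addn1 iotaD.
  rewrite rev_cat big_cat /= big_seq1 -/u.
  by rewrite atom_lt uk kk.
exact: H.
Qed.

Lemma moved_exists t : t <> 1 -> exists x, t x != x.
Proof.
move=> t1; apply/existsP; rewrite -negb_forall; apply/negP => /forallP h.
by apply: t1; apply/permP => x; rewrite perm1; apply/eqP.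
Qed.

(** A product of simple elements that is simple in the symmetric group is
    simple in the monoid: split transpositions off t and s simultaneously. *)
Lemma simple_mul t s : noncrossing t -> noncrossing s -> refines t s ->
  simple t * simple (t^-1 * s) = simple s.
Proof.
have [m] := ubnP #|[pred x | t x != x]|; elim: m t s => // m IH t s tm tt ss ts.
have [->|/eqP/moved_exists[x tx]] := eqVneq t 1.
  by rewrite simple1 invg1 !mul1g.
have at_ : refines (tperm x (t x)) t by apply: tperm_image_refines.
have as_ : refines (tperm x (t x)) s by apply: refines_trans at_ ts.
have xt : x != t x by rewrite eq_sym.
have aa : noncrossing (tperm x (t x)) by apply: noncrossing_tperm.
have E : (tperm x (t x))^-1 = tperm x (t x) by rewrite tpermV.
have t1 : noncrossing (tperm x (t x) * t).
  by rewrite -E; apply: noncrossing_quotient.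
have s1 : noncrossing (tperm x (t x) * s).
  by rewrite -E; apply: noncrossing_quotient.
have l1 : refines (tperm x (t x) * t) (tperm x (t x) * s).
  by rewrite -E; apply: refines_quotient.
rewrite -(atom_simple tt xt at_) -(atom_simple ss xt as_) -mulgA.
have -> : t^-1 * s = (tperm x (t x) * t)^-1 * (tperm x (t x) * s).
  by rewrite invgM -mulgA mulKg.
rewrite IH //; apply: leq_trans (tm : (_ <= m)%N); apply: proper_card.
apply/properP; split.
  apply/fintype.subsetP => y; rewrite !inE permM; apply: contraNneq => ty.
  case: tpermP => [e|e|_ _]; last by rewrite ty.
    by move: tx; rewrite -e ty eqxx.
  by move: tx; rewrite -(inj_eq (@perm_inj _ t)) -e ty eqxx.
exists (t x); rewrite !inE ?permM ?tpermR ?eqxx //.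
by rewrite (inj_eq (@perm_inj _ t)).
Qed.
End Simple.

(** * Greatest simple divisors and left cancellation *)

Section HeadTail.
Variable n : nat.
Local Notation M := (bkl n.+1).
Local Notation delta := (delta n).
Implicit Types r s t : {perm 'I_n.+1}.
Local Notation gen := (pres_gen (@bkl_rel n.+1)).
Implicit Types i j p : 'I_n.+1.
Implicit Types x y z : M.
Implicit Types a b : bkl_idx n.+1.

Lemma noncrossing_mul r t : noncrossing r -> noncrossing t ->
  refines t (complement r) -> noncrossing (r * t) /\ refines r (r * t).
Proof.
move=> rr tt tr; split; first exact: refines_mul.
by rewrite -{1}[r]mulg1; apply: refines_mul => //; apply: refines1.
Qed.

Lemma simple_mul_complement r t : noncrossing r -> noncrossing t ->
  refines t (complement r) -> simple (r * t) = simple r * simple t.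
Proof.
move=> rr tt tr; have [rt rrt] := noncrossing_mul rr tt tr.
by rewrite -(simple_mul rr rt rrt) mulKg.
Qed.

(** Left multiplication by the simple element r on a product of a simple
    element s, its greatest simple left divisor, and a tail y. The part of s
    that r can absorb while staying simple is the meet of s with the
    complement of r. *)
Definition push r (sy : {perm 'I_n.+1} * M) :=
  let t := meet sy.1 (complement r) in (r * t, simple (t^-1 * sy.1) * sy.2).

Lemma push_noncrossing r sy : noncrossing r -> noncrossing sy.1 ->
  [/\ noncrossing (push r sy).1, refines r (push r sy).1 &
      simple (push r sy).1 * (push r sy).2 = simple r * (simple sy.1 * sy.2)].
Proof.
case: sy => s y /= rr ss.
have [tt ts tr _] := meetP ss (noncrossing_complement rr).
have [A B] := noncrossing_mul rr tt tr.
split => //; rewrite simple_mul_complement // -mulgA; congr (_ * _).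
by rewrite mulgA simple_mul.
Qed.

(** What b and r absorb one after the other is what their product absorbs:
    left multiplication by r is an isomorphism from the divisors of the
    complement of b * r to the multiples of r that divide the complement of b,
    hence compatible with meets. *)
Lemma push_push (b r : {perm 'I_n.+1}) sy : noncrossing b -> noncrossing r ->
  refines r (complement b) -> noncrossing sy.1 ->
  push b (push r sy) = push (b * r) sy.
Proof.
case: sy => s y /= bb rr rb ss; rewrite /push /=.
have br : noncrossing (b * r) by case: (noncrossing_mul bb rr rb).
have brE : complement (b * r) = r^-1 * complement b.
  by rewrite /complement invgM -mulgA.
have [tt ts tr tmax] := meetP ss (noncrossing_complement rr).
have [uu us ubr umax] := meetP ss (noncrossing_complement br).
move: tt ts tr tmax uu us ubr umax; rewrite brE.
set t := meet s (complement r); set u := meet s _.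
move=> tt ts tr tmax uu us ubr umax.
have [rt rrt] := noncrossing_mul rr tt tr.
have [mm mrt mb mmax] := meetP rt (noncrossing_complement bb).
have lr : refines (r^-1 * complement b) (complement r).
  by apply: refines_quotient => //; apply: refines_cycle.
have ll : noncrossing (r^-1 * complement b).
  by apply: noncrossing_quotient => //; apply: noncrossing_complement.
have ur : refines u (complement r).
  by apply: (refines_trans ll _ ubr lr); apply: noncrossing_complement.
have ut : refines u t by apply: tmax.
have mE : meet (r * t) (complement b) = r * u.
  apply: refines_anti.
    apply: mmax; first exact: refines_mul.
    by rewrite -[X in refines _ X](mulVKg r); apply: refines_mul.
  have rm : refines r (meet (r * t) (complement b)) by apply: mmax.
  have lt : refines (r^-1 * meet (r * t) (complement b)) t.
    by rewrite -[X in refines _ X](mulKg r t); apply: refines_quotient.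
  have lu : refines (r^-1 * meet (r * t) (complement b)) u.
    by apply: umax; [apply: refines_trans lt ts | apply: refines_quotient].
  rewrite -[X in refines X _](mulVKg r); apply: refines_mul => //.
  by apply: (refines_trans tt _ lt tr); apply: noncrossing_complement.
rewrite mE; congr pair; first exact: mulgA.
rewrite (mulgA (simple _) (simple _)); congr (_ * _).
have -> : (r * u)^-1 * (r * t) = u^-1 * t by rewrite invgM -mulgA mulKg.
have -> : t^-1 * s = (u^-1 * t)^-1 * (u^-1 * s).
  by rewrite invgM invgK -mulgA mulVKg.
apply: simple_mul; first exact: noncrossing_quotient.
  exact: noncrossing_quotient.
exact: refines_quotient.
Qed.

Lemma tperm_complement r i j :
  (forall z : 'I_n.+1, gapr z (r z) i = gapr z (r z) j) ->
    refines (tperm i j) (complement r).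
Proof.
move=> h; apply: tperm_refines => z; rewrite -(permKV r z) complementE.
by have := h (r^-1 z); rewrite !gapr_complement => /negb_inj.
Qed.

(** The complement of (i j) has two cycles: the points after i up to j, and
    the others. *)
Lemma tperm_complement_tperm i j p (q : 'I_n.+1) : (i < j)%N ->
  gapr i j p = gapr i j q -> refines (tperm p q) (complement (tperm i j)).
Proof.
move=> ij h; apply: tperm_complement => z.
have ltp := ltn_ord p; have ltq := ltn_ord q.
case: tpermP => [->//|->|_ _]; move: h ij; rewrite /gapr /gap; lia.
Qed.

Definition low a : 'I_n.+1 := inord (val a).2.-1.
Definition high a : 'I_n.+1 := inord (val a).1.-1.
Definition swap a := tperm (low a) (high a).

Lemma lowE a : (low a).+1 = (val a).2 :> nat.
Proof. by rewrite /low; case: a => -[t s] /= h; rewrite inordK; lia. Qed.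

Lemma highE a : (high a).+1 = (val a).1 :> nat.
Proof. by rewrite /high; case: a => -[t s] /= h; rewrite inordK; lia. Qed.

Lemma low_high a : (low a < high a)%N.
Proof. by rewrite -ltnS lowE highE; case: a => -[t s] /= h; lia. Qed.

Lemma noncrossing_swap a : noncrossing (swap a).
Proof. exact: noncrossing_tperm. Qed.

Lemma pres_gen_atom a : gen a = atom (low a) (high a).
Proof. by rewrite (atom_lt (low_high a)) lowE highE bkl_aE. Qed.

Lemma simple_swap a : simple (swap a) = gen a.
Proof. by rewrite /swap simple_tperm pres_gen_atom. Qed.

(** Both sides of a BKL relation are two-letter factorizations of the same
    noncrossing permutation. *)
Lemma bkl_rel_swap u v : bkl_rel u v -> exists a b a' b',
  [/\ u = [:: a; b], v = [:: a'; b'], swap a * swap b = swap a' * swap b',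
     refines (swap b) (complement (swap a)) &
     refines (swap b') (complement (swap a'))].
Proof.
case=> [a b t s r q aE bE h|a b d t s r aE bE dE|a b d t s r aE bE dE].
- exists a, b, b, a; have := low_high a; have := low_high b.
  have := lowE a; have := lowE b; have := highE a; have := highE b.
  rewrite aE bE /= => hb ha lb la ltb lta.
  have st : (s < t)%N by lia.
  have qr : (q < r)%N by lia.
  have {h}nc := interleave h st qr; split => //.
  + rewrite /swap tperm_swap tpermV !tpermD //; rewrite -val_eqE /=;
    case: nc; lia.
  + by apply: tperm_complement_tperm => //; case: nc; rewrite /gapr /gap; lia.
  + by apply: tperm_complement_tperm => //; case: nc; rewrite /gapr /gap; lia.
- exists a, b, d, a; have := low_high a; have := low_high b.
  have := lowE a; have := lowE b; have := highE a; have := highE b.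
  have := lowE d; have := highE d.
  rewrite aE bE dE /= => hd ld hb ha lb la ltb lta.
  have e1 : high b = low a by apply: ord_inj; lia.
  have e2 : low d = low b by apply: ord_inj; lia.
  have e3 : high d = high a by apply: ord_inj; lia.
  split => //.
  + rewrite /swap e1 e2 e3 tperm_swap tpermV tpermL tpermD //;
    rewrite -val_eqE /=; lia.
  + by apply: tperm_complement_tperm => //; rewrite /gapr /gap; lia.
  + by apply: tperm_complement_tperm; rewrite /gapr /gap; lia.
- exists d, a, b, d; have := low_high a; have := low_high b.
  have := lowE a; have := lowE b; have := highE a; have := highE b.
  have := lowE d; have := highE d.
  rewrite aE bE dE /= => hd ld hb ha lb la ltb lta.
  have e1 : high b = low a by apply: ord_inj; lia.
  have e2 : low d = low b by apply: ord_inj; lia.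
  have e3 : high d = high a by apply: ord_inj; lia.
  split => //.
  + rewrite /swap e1 e2 e3 tperm_swap tpermV tpermR tpermD.
      by rewrite (tpermC (low a)).
    by rewrite -val_eqE /=; lia.
    by rewrite -val_eqE /=; lia.
  + by apply: tperm_complement_tperm; rewrite /gapr /gap; lia.
  + by apply: tperm_complement_tperm; rewrite /gapr /gap; lia.
Qed.

Definition split_word (w : seq (bkl_idx n.+1)) :=
  foldr (fun a => push (swap a)) (1, 1) w.

Lemma foldr_push_noncrossing w sy : noncrossing sy.1 ->
  noncrossing (foldr (fun a => push (swap a)) sy w).1.
Proof.
move=> ss; elim: w => //= a w IH.
by have [] := push_noncrossing (@noncrossing_swap a) IH.
Qed.

(** By [push_push], each side of a relation acts as the one simple element
    that both multiply to. *)
Lemma split_word_cong u v : pres_cong (@bkl_rel n.+1) u v ->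
  split_word u = split_word v.
Proof.
elim=> // [s t w _ -> _ -> //|p q s t].
case/bkl_rel_swap=> a [b [a' [b' [-> -> e h h']]]].
rewrite /split_word !foldr_cat; congr foldr => /=.
have qq : noncrossing (foldr (fun a => push (swap a)) (1, 1 : M) q).1.
  exact/foldr_push_noncrossing/noncrossing1.
by rewrite !push_push ?e //; apply: noncrossing_swap.
Qed.

Definition head_tail x := split_word (repr x).

Lemma head_tail_cons a x :
  head_tail (gen a * x) = push (swap a) (head_tail x).
Proof.
rewrite -[x]reprK /pres_gen [X in head_tail X]pres_mul_pi /head_tail.
rewrite (split_word_cong (pres_reprP _ _)) /=; congr push.
by rewrite (split_word_cong (pres_reprP _ _)).
Qed.

Lemma head_tail1 : head_tail 1 = (1, 1).
Proof. by rewrite /head_tail (split_word_cong (pres_reprP _ _)). Qed.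

Lemma bkl_ind (P : M -> Prop) : P 1 ->
  (forall a x, P x -> P (gen a * x)) -> forall x, P x.
Proof.
move=> P1 PM x; rewrite -[x]reprK -pres_prod_gen.
elim: (repr x) => [|a w IH]; first by rewrite big_nil.
by rewrite big_cons; apply: PM.
Qed.

Definition simple_head x := (head_tail x).1.
Definition simple_tail x := (head_tail x).2.

Lemma head_noncrossing x : noncrossing (simple_head x).
Proof. exact/foldr_push_noncrossing/noncrossing1. Qed.

Lemma head_tailE x : simple (simple_head x) * simple_tail x = x.
Proof.
rewrite /simple_head /simple_tail; elim/bkl_ind: x => [|a x IH].
  by rewrite head_tail1 simple1 mulg1.
rewrite head_tail_cons.
have [_ _ ->] := push_noncrossing (@noncrossing_swap a) (@head_noncrossing x).
by rewrite IH simple_swap.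
Qed.

(** Left cancellation. The head of a * x determines which part of the head of
    x was absorbed, and the tail of a * x determines what was left of x. *)
Lemma gen_inj a x y : gen a * x = gen a * y -> x = y.
Proof.
move=> e; have := head_tail_cons a x; rewrite e head_tail_cons.
rewrite /push => -[/mulgI E1 E2].
have cc := noncrossing_complement (@noncrossing_swap a).
have [tx hx _ _] := meetP (@head_noncrossing x) cc.
have [ty hy _ _] := meetP (@head_noncrossing y) cc.
rewrite -(head_tailE x) -(head_tailE y) -(simple_mul tx _ hx) //; last first.
  exact: head_noncrossing.
rewrite -(simple_mul ty _ hy) //; last exact: head_noncrossing.
by rewrite -!mulgA; congr (simple _ * _).
Qed.

Lemma bkl_mulI z x y : z * x = z * y -> x = y.
Proof.
elim/bkl_ind: z x y => [|a z IH] x y; first by rewrite !mul1g.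
by rewrite -!mulgA => /gen_inj/IH.
Qed.

Lemma gen_dvd_head a x : ldiv (gen a) x -> refines (swap a) (simple_head x).
Proof.
case=> y <-; rewrite /simple_head head_tail_cons.
by have [_] := push_noncrossing (@noncrossing_swap a) (@head_noncrossing y).
Qed.

Lemma simple_dvd t x : noncrossing t -> refines t (simple_head x) ->
  ldiv (simple t) x.
Proof.
move=> tt tx; exists (simple (t^-1 * simple_head x) * simple_tail x).
by rewrite mulgA simple_mul ?head_tailE //; apply: head_noncrossing.
Qed.
End HeadTail.

(** * Length, greatest common divisors and greedy normal forms *)

Section Garside.
Variable n : nat.
Local Notation M := (bkl n.+1).
Local Notation delta := (delta n).
Local Notation gen := (pres_gen (@bkl_rel n.+1)).
Implicit Types s t : {perm 'I_n.+1}.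
Implicit Types x y z d e : M.
Implicit Types a b : bkl_idx n.+1.

Definition len x := size (repr x).

Lemma size_cong u v : pres_cong (@bkl_rel n.+1) u v -> size u = size v.
Proof.
elim=> // [s t w _ -> _ -> //|p q s t st].
by rewrite !size_cat; case: st.
Qed.

Lemma lenM x y : len (x * y) = (len x + len y)%N.
Proof. by rewrite /len (size_cong (pres_reprP _ _)) size_cat. Qed.

Lemma len1 : len 1 = 0%N.
Proof. by rewrite /len (size_cong (pres_reprP _ _)). Qed.

Lemma len_gen a : len (gen a) = 1%N.
Proof. by rewrite /len (size_cong (pres_reprP _ _)). Qed.

Lemma len_eq0 x : len x = 0%N -> x = 1.
Proof. by elim/bkl_ind: x => // a x _; rewrite lenM len_gen. Qed.

Lemma ldiv1 x : ldiv 1 x.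
Proof. by exists x; rewrite mul1g. Qed.

Lemma ldiv_mull z x y : ldiv (z * x) (z * y) <-> ldiv x y.
Proof.
split=> -[c]; first by rewrite -mulgA => /bkl_mulI <-; exists c.
by move <-; exists c; rewrite mulgA.
Qed.

Lemma gen_simple a s : noncrossing s -> refines (swap a) s ->
  gen a * simple (swap a * s) = simple s.
Proof.
move=> ss sa; rewrite pres_gen_atom; apply: atom_simple => //.
by rewrite -val_eqE /= neq_ltn low_high.
Qed.

(** If no generator divides both, 1 will do. Otherwise let g be the meet of
    the heads of x and y, with x = g x1 and y = g y1, and let d be a greatest
    common divisor of x1 and y1 by induction on length. A common divisor
    starts with some generator b that divides g, say g = b k. After cancelling
    b, it divides the greatest common divisor of k x1 and k y1. That one is k
    d: it is a multiple of k d, and cancelling k in a proper multiple would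
    give a common divisor of x1 and y1 beyond d. *)
Lemma lgcd_exists x y : exists d, is_lgcd x y d.
Proof.
have [m] := ubnP (len x); elim: m x y => // m IH x y xm.
have [[a [ax ay]]|none] := pselect (exists a, ldiv (gen a) x /\ ldiv (gen a) y);
    last first.
  exists 1; split; try exact: ldiv1.
  elim/bkl_ind => [|a e _ [f ex] [g ey]]; first by move=> *; apply: ldiv1.
  by case: none; exists a; split; [exists (e * f) | exists (e * g)];
    rewrite mulgA.
have [gg gx gy gmax] := meetP (@head_noncrossing _ x) (@head_noncrossing _ y).
have ldivg b : ldiv (gen b) x -> ldiv (gen b) y ->
    gen b * simple (swap b * meet (simple_head x) (simple_head y)) =
    simple (meet (simple_head x) (simple_head y)).
  by move=> bx b_y; apply: gen_simple => //; apply: gmax; apply: gen_dvd_head.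
have := simple_dvd gg gx; have := simple_dvd gg gy.
move: ldivg; set g := meet _ _ => ldivg [y1 y1E] [x1 x1E].
have lg : (0 < len (simple g))%N by rewrite -(ldivg a ax ay) lenM len_gen.
have lx : (len x1 < m)%N.
  by move: xm; rewrite -x1E lenM; move: (len _) (len _) lg => *; lia.
have [d [dx dy dmax]] := IH x1 y1 lx.
exists (simple g * d); split;
  [by rewrite -x1E ldiv_mull | by rewrite -y1E ldiv_mull|].
elim/bkl_ind => [|b e _ bx b_y]; first by move=> *; apply: ldiv1.
have gE : gen b * simple (swap b * g) = simple g.
  case: bx => u bx; case: b_y => v b_y.
  by apply: ldivg; [exists (e * u) | exists (e * v)]; rewrite mulgA.
move: gE; set k := simple (swap b * g) => gE.
rewrite -x1E -gE -mulgA ldiv_mull in bx.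
rewrite -y1E -gE -mulgA ldiv_mull in b_y.
have lk : (len (k * x1)%g < m)%N.
  by move: xm; rewrite -x1E -gE !lenM len_gen; move: (len _) (len _) => *; lia.
have [h [hx hy hmax]] := IH (k * x1) (k * y1) lk.
have [f fE] : ldiv (k * d) h by apply: hmax; rewrite ldiv_mull.
have f1 : f = 1.
  rewrite -fE -mulgA !ldiv_mull in hx hy.
  have [c cE] := dmax _ hx hy.
  apply: len_eq0; have := congr1 len cE; rewrite !lenM.
  by move: (len _) (len _) (len _) => *; lia.
rewrite -gE -mulgA ldiv_mull; have := hmax _ bx b_y.
by rewrite -fE f1 mulg1.
Qed.

Lemma simple_complement s : noncrossing s ->
  simple s * simple (complement s) = delta.
Proof.
move=> ss; rewrite -simple_delta /complement simple_mul //.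
  exact: noncrossing_cycle.
exact: refines_cycle.
Qed.

Lemma gen_dvd_delta a : ldiv (gen a) delta.
Proof.
by rewrite -simple_swap; eexists; apply: simple_complement;
  apply: noncrossing_swap.
Qed.

(** The factors are nontrivial because every generator divides delta, so the
    length drops at each step. *)
Lemma greedy_nf_exists x : exists ss, greedy_nf x ss.
Proof.
have [m] := ubnP (len x); elim: m x => // m IH x xm.
have [->|x1] := pselect (x = 1); first by exists [::]; apply: greedy_nil.
have [s sx] := lgcd_exists delta x; have [_ [y yE] smax] := sx.
have ls : (0 < len s)%N.
  move: x1 smax; elim/bkl_ind: (x) => // a z _ _ /(_ (gen a) (gen_dvd_delta a)).
  by case=> [|f <-]; [exists z | rewrite lenM len_gen].
have [|ss yss] := IH y.
  by move: xm; rewrite -yE lenM; move: (len _) (len _) ls => *; lia.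
by exists (s :: ss); apply: (greedy_cons x1 sx yE yss).
Qed.

Lemma greedy_nf_len x ss : greedy_nf x ss -> len x = (\sum_(s <- ss) len s)%N.
Proof.
elim=> [|{}x s y {}ss _ _ <- _ IH]; first by rewrite big_nil len1.
by rewrite big_cons lenM IH.
Qed.

Lemma greedy_nf_prod x ss : greedy_nf x ss -> x = \prod_(s <- ss) s.
Proof.
elim=> [|{}x s y {}ss _ _ <- _ IH]; first by rewrite big_nil.
by rewrite big_cons -IH.
Qed.

Lemma len_delta : len delta = n.
Proof.
rewrite /delta /bkl_delta [X in iota 1 X]/=.
have H k : (k <= n)%N ->
    len (\prod_(i <- rev (iota 1 k)) bkl_a n.+1 i.+1 i) = k.
  elim: k => [|k IH] kn; first by rewrite big_nil len1.
  have -> : iota 1 k.+1 = iota 1 k ++ [:: k.+1].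
    by rewrite -[X in iota 1 X]addn1 iotaD.
  rewrite rev_cat big_cat big_seq1 lenM IH; last exact: ltnW.
  pose ij := (k.+2, k.+1).
  have h : (1 <= ij.2)%N && (ij.2 < ij.1 <= n.+1)%N.
    by rewrite /= ltnSn.
  by rewrite (bkl_aE (exist _ ij h : bkl_idx n.+1)) len_gen.
exact: (H n).
Qed.

(** * Conjugation by delta *)

(** Both sides are the product of s with its complement and with the
    complement of that complement. *)
Lemma simple_delta_comm s : noncrossing s ->
  simple s * delta = delta * simple (complement (complement s)).
Proof.
move=> ss; have cc := noncrossing_complement ss.
by rewrite -{1}(simple_complement cc) mulgA simple_complement.
Qed.

Lemma delta_shift_exists x : exists y, x * delta = delta * y.
Proof.
elim/bkl_ind: x => [|a x [y xy]]; first by exists 1; rewrite mul1g mulg1.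
exists (simple (complement (complement (swap a))) * y).
have sa := @simple_delta_comm (swap a) (@noncrossing_swap _ a).
by rewrite -mulgA xy (mulgA (gen a)) (mulgA delta) -sa simple_swap.
Qed.

(** Conjugation by delta, as an endomorphism of the monoid; it exists because
    delta is quasi-central and is unique by left cancellation. *)
Definition shift x : M := sval (cid (delta_shift_exists x)).

Lemma shiftE x : x * delta = delta * shift x.
Proof. exact: svalP (cid (delta_shift_exists x)). Qed.

Lemma shift_uniq x y : x * delta = delta * y -> shift x = y.
Proof. by rewrite shiftE => /bkl_mulI. Qed.

Lemma shiftM x y : shift (x * y) = shift x * shift y.
Proof. by apply: shift_uniq; rewrite -mulgA shiftE !mulgA shiftE. Qed.

Lemma shift1 : shift 1 = 1.
Proof. by apply: shift_uniq; rewrite mul1g mulg1. Qed.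

Lemma shift_delta : shift delta = delta.
Proof. exact: shift_uniq. Qed.

Lemma complementK s : complement (complement s) = s ^ long_cycle n.
Proof. by rewrite /complement conjgE invgM invgK -mulgA. Qed.

Lemma shift_simple k s : noncrossing s ->
  iter k shift (simple s) = simple (s ^ (long_cycle n ^+ k)).
Proof.
move=> ss.
have H : iter k shift (simple s) = simple (s ^ (long_cycle n ^+ k)) /\
    noncrossing (s ^ (long_cycle n ^+ k)).
  elim: k => [|k [IH nk]]; first by rewrite expg0 conjg1.
  rewrite iterS IH expgSr conjgM -complementK; split.
    by apply: shift_uniq; apply: simple_delta_comm.
  by do 2!apply: noncrossing_complement.
by case: H.
Qed.

Lemma iter_shiftM k x y :
  iter k shift (x * y) = iter k shift x * iter k shift y.
Proof. by elim: k => //= k ->; rewrite shiftM. Qed.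

(** On simple elements [shift] is conjugation by the long cycle, which has
    finite order. Thus [shift] is bijective, and delta can be cancelled on the
    right as well. *)
Lemma shift_periodic : exists p, forall x, iter p.+1 shift x = x.
Proof.
pose c := long_cycle n; exists (fingroup.order c).-1 => x.
rewrite prednK; last exact: fingroup.order_gt0.
elim/bkl_ind: x => [|a x IH].
  by elim: (fingroup.order c) => // k IH; rewrite iterS IH shift1.
rewrite iter_shiftM IH -simple_swap shift_simple; last exact: noncrossing_swap.
by rewrite fingroup.expg_order conjg1.
Qed.

Lemma shift_inj : injective shift.
Proof.
have [p sp] := shift_periodic.
by move=> x y e; rewrite -(sp x) -(sp y) !iterSr e.
Qed.

Lemma shift_surj y : exists x, shift x = y.
Proof.
by have [p sp] := shift_periodic; exists (iter p shift y); apply: sp.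
Qed.

Lemma mul_delta_inj x y : x * delta = y * delta -> x = y.
Proof. by rewrite !shiftE => /bkl_mulI/shift_inj. Qed.

(** Cancel x in x y (shift x) = delta (shift x) = x delta. *)
Lemma complement_shift x y : x * y = delta -> y * shift x = delta.
Proof. by move=> xy; apply: (@bkl_mulI _ x); rewrite mulgA xy -shiftE. Qed.

Lemma complement_left x y : x * y = delta -> exists z, z * x = delta.
Proof.
move=> /complement_shift yx; have [z zy] := shift_surj y.
by exists z; apply: shift_inj; rewrite shiftM zy yx shift_delta.
Qed.

(** A high enough power of delta is thus a common left multiple of any two
    elements, which is the Ore condition. *)
Lemma left_multiple x : exists k y, y * x = delta ^+ k.
Proof.
elim/bkl_ind: x => [|a x [k [y yx]]]; first by exists 0%N, 1; rewrite mulg1.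
have [b /complement_left[l la]] := gen_dvd_delta a.
have [w wy] := shift_surj y; exists k.+1, (w * l).
by rewrite -mulgA (mulgA l) la mulgA shiftE wy -mulgA yx expgS.
Qed.
End Garside.

(** * The embedding of the BKL monoid in the braid group *)

Section Fractions.
Variable n : nat.
Local Notation M := (bkl n.+1).
Local Notation B := (braid n.+1).
Local Notation delta := (delta n).
Local Notation gen := (pres_gen (@bkl_rel n.+1)).
Implicit Types x y : M.
Implicit Types a b : bkl_idx n.+1.
Implicit Types z : M * nat.

(** The pair (m, k) stands for the fraction m delta^-k. The braid group acts
    on these fractions by left multiplication, and since an element of the
    monoid acts as itself, the monoid embeds in the braid group. *)
Definition frac_eq z z' := z.1 * delta ^+ z'.2 = z'.1 * delta ^+ z.2.

Lemma mul_deltaX_inj k x y : x * delta ^+ k = y * delta ^+ k -> x = y.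
Proof.
elim: k => [|k IH]; first by rewrite !mulg1.
by rewrite expgSr !mulgA => /mul_delta_inj/IH.
Qed.

Lemma deltaXC k l : delta ^+ k * delta ^+ l = delta ^+ l * delta ^+ k.
Proof. by rewrite -!expgnDr addnC. Qed.

Lemma frac_eq_refl z : frac_eq z z. Proof. by []. Qed.

Lemma frac_eq_sym z z' : frac_eq z z' -> frac_eq z' z.
Proof. by move=> e; symmetry. Qed.

Lemma frac_eq_trans z1 z2 z3 : frac_eq z1 z2 -> frac_eq z2 z3 -> frac_eq z1 z3.
Proof.
rewrite /frac_eq => e1 e2; apply: (@mul_deltaX_inj z2.2).
by rewrite -mulgA deltaXC mulgA e1 -mulgA deltaXC mulgA e2 -!mulgA deltaXC.
Qed.

Definition mul_frac x z := (x * z.1, z.2).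

Lemma mul_frac_eq x z z' : frac_eq z z' ->
  frac_eq (mul_frac x z) (mul_frac x z').
Proof. by rewrite /frac_eq /= -!mulgA => ->. Qed.

Definition cogen a := simple (complement (swap a)).

Lemma gen_cogen a : gen a * cogen a = delta.
Proof.
rewrite -simple_swap; apply: simple_complement; exact: noncrossing_swap.
Qed.

(** Left division by a generator a: its inverse is [cogen a] * delta^-1, and
    delta^-1 moves to the right of m through [shift]. *)
Definition div_frac a z := (cogen a * shift z.1, z.2.+1).

Lemma div_frac_eq a z z' : frac_eq z z' ->
  frac_eq (div_frac a z) (div_frac a z').
Proof.
rewrite /frac_eq /= -!mulgA => /(congr1 (@shift n)); rewrite !shiftM.
have H k : shift (delta ^+ k) = delta ^+ k.
  by elim: k => [|k IH]; rewrite ?shift1 // expgS shiftM IH shift_delta.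
by rewrite !H !expgSr !mulgA => e; rewrite -!(mulgA (cogen a)) e.
Qed.

Lemma mul_divK a z : frac_eq (mul_frac (gen a) (div_frac a z)) z.
Proof. by rewrite /frac_eq /= mulgA gen_cogen -shiftE -mulgA -expgS. Qed.

Lemma div_mulK a z : frac_eq (div_frac a (mul_frac (gen a) z)) z.
Proof.
rewrite /frac_eq /= shiftM mulgA (complement_shift (gen_cogen a)) -shiftE.
by rewrite -mulgA -expgS.
Qed.

Lemma artin_idx_bkl_subproof (i : artin_idx n.+1) :
  (1 <= ((val i).+1, val i).2)%N &&
  (((val i).+1, val i).2 < ((val i).+1, val i).1 <= n.+1)%N.
Proof. by case: i => i /=; lia. Qed.

Definition artin_bkl (i : artin_idx n.+1) : bkl_idx n.+1 :=
  exist _ ((val i).+1, val i) (artin_idx_bkl_subproof i).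

Definition letter_act (l : artin_idx n.+1 * bool) z :=
  if l.2 then div_frac (artin_bkl l.1) z else mul_frac (gen (artin_bkl l.1)) z.

Lemma letter_act_eq l z z' : frac_eq z z' ->
  frac_eq (letter_act l z) (letter_act l z').
Proof.
by rewrite /letter_act; case: l.2; [apply: div_frac_eq | apply: mul_frac_eq].
Qed.

Lemma word_act_eq w z z' : frac_eq z z' ->
  frac_eq (foldr letter_act z w) (foldr letter_act z' w).
Proof. by move=> e; elim: w => //= l w; apply: letter_act_eq. Qed.

Lemma artin_rel_act (u v : seq (artin_idx n.+1)) z : artin_rel u v ->
  foldr letter_act z [seq (i, false) | i <- u] =
  foldr letter_act z [seq (i, false) | i <- v].
Proof.
have genE i : gen (artin_bkl i) = bkl_a n.+1 (val i).+1 (val i).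
  by rewrite -bkl_aE.
case=> i j ij; rewrite /= /letter_act /mul_frac /= !genE !mulgA.
  have [||||E1 E2] := @bkl_a_triangle n.+1 (val i).+2 (val i).+1 (val i) => //.
  - by have := valP i => /=; lia.
  - by have := valP j; rewrite ij.
  by rewrite ij -(mulgA (bkl_a _ _ _)) E1 mulgA -E2.
congr (_, _); congr (_ * _); apply: bkl_a_comm;
  have := valP i; have := valP j; move: (val i) (val j) ij => p q /=; lia.
Qed.

(** The Artin relations hold among the atoms of neighbouring indices, so words
    for the same braid act in the same way. *)
Lemma pres_cong_act u v z : pres_cong (group_rel (@artin_rel n.+1)) u v ->
  frac_eq (foldr letter_act z u) (foldr letter_act z v).
Proof.
move=> uv; elim: uv z => [s|s t _ IH|s t w _ IH1 _ IH2|p q s t st] z.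
- exact: frac_eq_refl.
- exact/frac_eq_sym/IH.
- exact: frac_eq_trans (IH1 z) (IH2 z).
rewrite !foldr_cat; apply: word_act_eq; move: (foldr _ _ q) => {q z} z.
case: st => [i [] | {}s {}t st] /=.
- exact: div_mulK.
- exact: mul_divK.
by rewrite (artin_rel_act _ st); apply: frac_eq_refl.
Qed.

Definition braid_act (g : B) z := foldr letter_act z (repr g).

Lemma braid_act_eq g z z' : frac_eq z z' ->
  frac_eq (braid_act g z) (braid_act g z').
Proof. exact: word_act_eq. Qed.

Lemma braid_actM g h z :
  frac_eq (braid_act (g * h) z) (braid_act g (braid_act h z)).
Proof. by rewrite /braid_act -foldr_cat; apply/pres_cong_act/pres_reprP. Qed.

Lemma braid_act1 z : frac_eq (braid_act 1 z) z.
Proof. exact: (pres_cong_act z (pres_reprP _ _)). Qed.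

Definition acts_as (g : B) x :=
  forall z, frac_eq (braid_act g z) (mul_frac x z).

Lemma acts_asM g h x y : acts_as g x -> acts_as h y -> acts_as (g * h) (x * y).
Proof.
move=> gx hy z; apply: frac_eq_trans (braid_actM g h z) _.
apply: frac_eq_trans (braid_act_eq g (hy z)) _.
by apply: frac_eq_trans (gx _) _; rewrite /mul_frac /= mulgA;
  apply: frac_eq_refl.
Qed.

(** Since [div_frac] inverts the action of a generator, right factors with a
    known action can be cancelled. *)
Lemma acts_as_cancel g h a x : acts_as h (gen a) ->
  acts_as (g * h) (x * gen a) ->
  acts_as g x.
Proof.
move=> ha gha z.
have e1 : frac_eq z (braid_act h (div_frac a z)).
  apply: frac_eq_sym; apply: frac_eq_trans (ha _) _; exact: mul_divK.
apply: frac_eq_trans (braid_act_eq g e1) _.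
apply: frac_eq_trans (frac_eq_sym (braid_actM _ _ _)) _.
apply: frac_eq_trans (gha _) _.
have -> : mul_frac (x * gen a) (div_frac a z)
  = mul_frac x (mul_frac (gen a) (div_frac a z)).
  by rewrite /mul_frac /= -mulgA.
by apply: mul_frac_eq; apply: mul_divK.
Qed.

Lemma acts_as_artin (i : artin_idx n.+1) :
  acts_as (artin_gen i) (gen (artin_bkl i)).
Proof. by move=> z; apply: (pres_cong_act z (pres_reprP _ _)). Qed.

Lemma acts_as_sigma i : (1 <= i <= n)%N ->
  acts_as (sigma n.+1 i) (bkl_a n.+1 i.+1 i).
Proof.
move=> h; have h' : (1 <= i < n.+1)%N by [].
rewrite /sigma insubT; have := acts_as_artin (Sub i h').
by rewrite -bkl_aE /=.
Qed.

(** The conjugation in the definition of [braid_a] becomes the identity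
    a_(t+1,t) a_(t,s) = a_(t+1,s) a_(t+1,t) after multiplication by sigma_t on
    the right. *)
Lemma acts_as_braid_a t s : (1 <= s)%N -> (s < t)%N -> (t <= n.+1)%N ->
  acts_as (braid_a n.+1 t s) (bkl_a n.+1 t s).
Proof.
move=> s1; elim: t => // t IH; rewrite ltnS leq_eqVlt => /orP[/eqP <-|st] tn.
  by rewrite braid_aS; apply: acts_as_sigma; lia.
have tn' : (1 <= t <= n)%N by lia.
have st' := acts_as_sigma tn'.
have ht : (1 <= t < n.+1)%N by lia.
pose a := artin_bkl (exist _ t ht : artin_idx n.+1).
have aE : gen a = bkl_a n.+1 t.+1 t by rewrite -bkl_aE.
apply: (@acts_as_cancel _ (sigma n.+1 t) a); first by rewrite aE.
have [E _] := bkl_a_triangle s1 st (ltnSn t) tn.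
rewrite aE -E braid_a_rec // mulgVK.
by apply: acts_asM => //; apply: IH => //; apply: ltnW.
Qed.

Lemma bkl_braid1 : bkl_braid (1 : M) = 1.
Proof. by case: (bkl_braid_monoid_morphism n.+1). Qed.

Lemma bkl_braidM x y : bkl_braid (x * y) = bkl_braid x * bkl_braid y.
Proof. by case: (bkl_braid_monoid_morphism n.+1). Qed.

Lemma acts_as_bkl_braid x : acts_as (bkl_braid x) x.
Proof.
elim/bkl_ind: x => [|a x IH].
  move=> z; rewrite bkl_braid1; apply: frac_eq_trans (braid_act1 z) _.
  by rewrite /frac_eq /= mul1g.
rewrite bkl_braidM; apply: acts_asM => //.
rewrite bkl_braid_gen -bkl_aE /bkl_gen.
by case: a => -[t s] /= h; apply: acts_as_braid_a; lia.
Qed.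

(** The fraction (1, 0) is sent to (x, 0), and such fractions are equal only
    if the numerators are. *)
Lemma bkl_braid_inj : injective (@bkl_braid n.+1).
Proof.
move=> x y e; have := acts_as_bkl_braid y (1, 0%N); rewrite -e.
move=> /(frac_eq_trans (frac_eq_sym (acts_as_bkl_braid x (1, 0%N)))).
by rewrite /frac_eq /= !mulg1.
Qed.
End Fractions.

(** * Word length in a group *)

Lemma min_natP (P : nat -> Prop) k : P k ->
  P (min_nat P) /\ forall m, P m -> (min_nat P <= m)%N.
Proof.
move=> Pk; rewrite /min_nat.
set S := [set m | P m /\ forall l, P l -> (m <= l)%N]%classic.
suff [m Sm] : exists m, S m by exact: (@xgetPex _ 0%N S (ex_intro _ m Sm)).
have exP : exists k, `[< P k >] by exists k; apply/asboolP.
case: (ex_minnP exP) => m /asboolP Pm mmin; exists m; split=> // l Pl.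
by apply: mmin; apply/asboolP.
Qed.

Section WordLength.
Variables (G : groupType) (A : Type) (g : A -> G).
Implicit Types (w : seq (A * bool)) (x y : G).

Lemma word_length_le w : (word_length g (signed_prod g w) <= size w)%N.
Proof.
by have [_] := @min_natP
  (fun k => exists2 w', size w' = k & signed_prod g w = signed_prod g w') _
  (ex_intro2 _ _ w erefl erefl); apply; exists w.
Qed.

Lemma word_length_word w :
  exists2 w', size w' = word_length g (signed_prod g w) &
    signed_prod g w = signed_prod g w'.
Proof.
by have [] := @min_natP
  (fun k => exists2 w', size w' = k & signed_prod g w = signed_prod g w') _
  (ex_intro2 _ _ w erefl erefl).
Qed.

Lemma signed_prod_cat w w' :
  signed_prod g (w ++ w') = signed_prod g w * signed_prod g w'.
Proof. by rewrite /signed_prod big_cat. Qed.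

Lemma signed_prod_inv w :
  signed_prod g (rev [seq (l.1, ~~ l.2) | l <- w]) = (signed_prod g w)^-1.
Proof.
elim: w => [|[a b] w IH]; first by rewrite /signed_prod !big_nil invg1.
rewrite /= rev_cons -cats1 signed_prod_cat IH /signed_prod big_seq1 big_cons
  invgM.
by case: b; rewrite /= ?invgK.
Qed.

Hypothesis g_gen : forall x, exists w, x = signed_prod g w.

Lemma word_lengthM x y :
  (word_length g (x * y) <= word_length g x + word_length g y)%N.
Proof.
have [w ->] := g_gen x; have [w' ->] := g_gen y.
have [v <- ->] := word_length_word w; have [v' <- ->] := word_length_word w'.
by rewrite -signed_prod_cat (leq_trans (word_length_le _)) // size_cat.
Qed.

Lemma word_lengthV x : (word_length g x^-1 <= word_length g x)%N.
Proof.
have [w ->] := g_gen x; have [v <- ->] := word_length_word w.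
by rewrite -signed_prod_inv (leq_trans (word_length_le _)) // size_rev size_map.
Qed.

Lemma word_length1 : word_length g 1 = 0%N.
Proof.
by apply/eqP; rewrite -leqn0; have := word_length_le [::];
  rewrite /signed_prod big_nil.
Qed.

Lemma word_length_prod (I : Type) (r : seq I) (F : I -> G) :
  (word_length g (\prod_(i <- r) F i) <= \sum_(i <- r) word_length g (F i))%N.
Proof.
elim: r => [|i r IH]; first by rewrite !big_nil word_length1.
by rewrite !big_cons (leq_trans (word_lengthM _ _)) // leq_add2l.
Qed.
End WordLength.

Lemma group_gen_inv (A : choiceType) (R : seq A -> seq A -> Prop) a :
  (group_gen R a)^-1 = pres_gen (group_rel R) (a, true).
Proof.
apply: (@mulgI _ (group_gen R a)); rewrite mulgV /group_gen /pres_gen.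
symmetry; rewrite [LHS]pres_mul_pi; apply/pres_eqP.
exact: (pres_step [::] [::] (group_rel_cancel R a false)).
Qed.

Lemma group_gen_surj (A : choiceType) (R : seq A -> seq A -> Prop)
    (x : presented_group R) : exists w, x = signed_prod (@group_gen A R) w.
Proof.
exists (repr x); rewrite -[LHS]reprK -pres_prod_gen.
apply: eq_bigr => -[a []] _ //=.
by rewrite group_gen_inv.
Qed.

(** * Reduced fractions *)

Section Comparison.
Variable n : nat.
Local Notation M := (bkl n.+1).
Local Notation B := (braid n.+1).
Local Notation delta := (delta n).
Local Notation gen := (pres_gen (@bkl_rel n.+1)).
Local Notation ell1 := (@ell1 n.+1).
Local Notation ell2 := (@ell2 n.+1).
Local Notation phi := (@bkl_braid n.+1).
Implicit Types u v q r : M.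
Implicit Types x : B.

Lemma bkl_braid_prod ss : phi (\prod_(s <- ss) s) = \prod_(s <- ss) phi s.
Proof.
elim: ss => [|s ss IH]; first by rewrite !big_nil bkl_braid1.
by rewrite !big_cons bkl_braidM IH.
Qed.

Lemma bkl_word u :
  exists2 w, size w = len u & phi u = signed_prod (@bkl_gen n.+1) w.
Proof.
exists [seq (a, false) | a <- repr u]; first by rewrite size_map.
rewrite /signed_prod big_map /= -{1}[u]reprK -pres_prod_gen.
elim: (repr u) => [|a w IH]; first by rewrite !big_nil bkl_braid1.
by rewrite !big_cons bkl_braidM IH bkl_braid_gen.
Qed.

Lemma ell2_le_len u : (ell2 (phi u) <= len u)%N.
Proof. by have [w <- ->] := bkl_word u; apply: word_length_le. Qed.

Let ell1M := word_lengthM (@group_gen_surj _ (@artin_rel n.+1)).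
Let ell1V := word_lengthV (@group_gen_surj _ (@artin_rel n.+1)).
Let ell1_prod := word_length_prod (@group_gen_surj _ (@artin_rel n.+1)).

Lemma ell1_sigma i : (ell1 (sigma n.+1 i) <= 1)%N.
Proof.
rewrite /sigma; case: insub => [j|]; last by rewrite /ell1 word_length1.
have := word_length_le (@artin_gen n.+1) [:: (j, false)].
by rewrite /signed_prod big_seq1.
Qed.

Lemma ell1_braid_a t s : (s < t)%N ->
  (ell1 (braid_a n.+1 t s) <= 2 * (t - s) - 1)%N.
Proof.
elim: t => // t IH; rewrite ltnS leq_eqVlt => /orP[/eqP <-|st].
  by rewrite braid_aS (leq_trans (ell1_sigma _)) // subSnn.
rewrite braid_a_rec //; have := IH st; have := ell1_sigma t.
have := ell1M (sigma n.+1 t * braid_a n.+1 t s) (sigma n.+1 t)^-1.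
have := ell1M (sigma n.+1 t) (braid_a n.+1 t s); have := ell1V (sigma n.+1 t).
rewrite -!/(ell1 _).
move: (ell1 _) (ell1 _) (ell1 _) (ell1 _) (ell1 _) => *; lia.
Qed.

(** The longest conjugate is a_(N,1), with N-1 generators up to the middle one
    and N-2 inverses after it. *)
Lemma ell1_bkl_gen a : (ell1 (bkl_gen (N := n.+1) a) <= 2 * n.+1 - 3)%N.
Proof.
case: a => -[t s] /= h; rewrite /bkl_gen /=.
by have := @ell1_braid_a t s; move: (ell1 _) => *; lia.
Qed.

Lemma ell1_le_ell2 u : (ell1 (phi u) <= (2 * n.+1 - 3) * ell2 (phi u))%N.
Proof.
have [w' _ ->] := bkl_word u; rewrite /Defs.ell2.
have [w <- ->] := word_length_word (@bkl_gen n.+1) w'.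
apply: leq_trans (ell1_prod _ _) _; rewrite mulnC -sum1_size big_distrl /=.
apply: leq_sum => -[a b] _; rewrite mul1n /=.
have h := ell1_bkl_gen a.
case: b => //=; exact: leq_trans (ell1V _) h.
Qed.

Lemma fraction_reduced u0 v0 : exists u v f,
  [/\ is_lgcd u v 1, u0 = f * u & v0 = f * v].
Proof.
have [d [[u uE] [v vE] dmax]] := lgcd_exists u0 v0.
exists u, v, d; split => //; split; try exact: ldiv1.
move=> e [u' u'E] [v' v'E]; have [||f fE] := dmax (d * e).
- by exists u'; rewrite -mulgA u'E.
- by exists v'; rewrite -mulgA v'E.
by exists f; apply: (@bkl_mulI _ d); rewrite mulgA mulg1.
Qed.

(** A reduced fraction is the smallest one. By the Ore condition and the
    embedding, c u = e u0 and c v = e v0 in the monoid for some c and e. The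
    greatest common divisor of c u and c v is c, so e divides c, and the
    quotient is the factor f. *)
Lemma reduced_fraction_ldiv u v u0 v0 : is_lgcd u v 1 ->
  (phi u)^-1 * phi v = (phi u0)^-1 * phi v0 ->
  exists f, u0 = f * u /\ v0 = f * v.
Proof.
move=> [_ _ uv] E.
have [c [e cuE]] : exists c e, c * u = e * u0.
  have [k [c cE]] := left_multiple u; have [l [e eE]] := left_multiple u0.
  by exists (delta ^+ l * c), (delta ^+ k * e); rewrite -!mulgA cE eE deltaXC.
have cvE : c * v = e * v0.
  apply: bkl_braid_inj; rewrite !bkl_braidM -(mulVKg (phi u) (phi v)) E.
  by rewrite (mulgA (phi c)) -(bkl_braidM c) cuE bkl_braidM -mulgA mulVKg.
have [d [du dv dmax]] := lgcd_exists (c * u) (c * v).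
have [h hE] : ldiv c d by apply: dmax; [exists u | exists v].
rewrite -hE !ldiv_mull in du dv.
have [h' h'E] := uv _ du dv.
have [f fE] : ldiv e d by apply: dmax; [exists u0 | exists v0].
have cE : c = e * (f * h') by rewrite mulgA fE -hE -mulgA h'E mulg1.
exists (f * h'); split; apply: (@bkl_mulI _ e); rewrite mulgA -cE.
  by rewrite cuE.
by rewrite cvE.
Qed.

Lemma rational_nf_exists x : (exists u v, x = (phi u)^-1 * phi v) ->
  exists sp, rational_nf x sp.
Proof.
move=> [u0 [v0 xE]]; have [u [v [f [uv uE vE]]]] := fraction_reduced u0 v0.
have [ss uss] := greedy_nf_exists u; have [pp vpp] := greedy_nf_exists v.
exists (ss, pp), u, v; split => //.
by rewrite xE uE vE !bkl_braidM invgM -mulgA mulKg.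
Qed.

(** The normal form exists, so the choice in the definition of [ell2R] is
    one. *)
Lemma ell2RP x : (exists u v, x = (phi u)^-1 * phi v) -> exists u v ss pp,
  [/\ x = (phi u)^-1 * phi v, is_lgcd u v 1, greedy_nf u ss, greedy_nf v pp &
  ell2R x = (\sum_(s <- ss) ell2 (phi s) + \sum_(p <- pp) ell2 (phi p))%N].
Proof.
move=> /rational_nf_exists[sp0 sp0E].
have : rational_nf x (xget ([::], [::]) [set sp | rational_nf x sp]%classic).
  exact: (@xgetPex _ ([::], [::]) [set sp | rational_nf x sp]%classic
    (ex_intro _ sp0 sp0E)).
by rewrite /ell2R; case: (xget _ _) => ss pp [u [v [xE uv us vp]]];
  exists u, v, ss, pp.
Qed.

(** * Fractions with short factors *)

(** The divisors of delta other than delta itself, which has length n = N-1.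
    Excluding delta is what makes the constant N-2 rather than N-1. *)
Definition short_divisor q := (len q < n)%N /\ exists r, q * r = delta.

(** If q and r are nontrivial, delta is a common left multiple of both, and
    the cofactors are again short, because only 1 has delta as a cofactor. If
    one of them is 1, the other passes unchanged. *)
Lemma short_divisor_swap q r : short_divisor q -> short_divisor r ->
  exists q' r', [/\ short_divisor q', short_divisor r' & r' * q = q' * r].
Proof.
have [->|q1] := pselect (q = 1).
  by move=> Q1 Qr; exists 1, r; rewrite mulg1 mul1g.
have [->|r1] := pselect (r = 1).
  by move=> Qq Q1; exists q, 1; rewrite mulg1 mul1g.
have H s : s <> 1 -> short_divisor s ->
    exists2 s', short_divisor s' & s' * s = delta.
  move=> s1 [ls [t /complement_left[s' s's]]]; exists s' => //.
  split; last by exists s.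
  have : len s <> 0%N by move=> /len_eq0.
  by have := congr1 (@len n) s's; rewrite lenM len_delta; lia.
move=> /(H _ q1)[r' Qr' E] /(H _ r1)[q' Qq' E'].
by exists q', r'; rewrite E E'.
Qed.

Fixpoint short_product p v : Prop :=
  if p is p'.+1 then
    exists v' q, [/\ short_product p' v', short_divisor q & v = v' * q]
  else v = 1.

Lemma short_product_swap p v r : short_product p v -> short_divisor r ->
  exists r' v', [/\ short_divisor r', short_product p v' & r' * v = v' * r].
Proof.
elim: p v r => [|p IH] v r /=.
  by move=> -> Qr; exists r, 1; rewrite mulg1 mul1g.
move=> [v1 [q [Pv1 Qq ->]]] Qr.
have [q1 [r1 [Qq1 Qr1 E]]] := short_divisor_swap Qq Qr.
have [r' [v' [Qr' Pv' E']]] := IH _ _ Pv1 Qr1.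
exists r', (v' * q1); split => //; first by exists v', q1.
by rewrite mulgA E' -mulgA E mulgA.
Qed.

Lemma short_product_len p v : short_product p v -> (len v <= (n - 1) * p)%N.
Proof.
elim: p v => [|p IH] v /=; first by move=> ->; rewrite len1.
move=> [v' [q [/IH lv [lq _] ->]]]; rewrite lenM mulnS; lia.
Qed.

Hypothesis n2 : (2 <= n)%N.

Lemma short_divisor_gen a : short_divisor (gen a).
Proof. by split; [rewrite len_gen | apply: gen_dvd_delta]. Qed.

Lemma artin_gen_bkl (i : artin_idx n.+1) :
  artin_gen i = phi (gen (artin_bkl i)).
Proof.
rewrite bkl_braid_gen /bkl_gen /= braid_aS /sigma; case: i => i h /=.
by rewrite insubT.
Qed.

(** Inverse letters move to the left through the product of the preceding
    letters by [short_product_swap]. This keeps the number of factors on each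
    side and keeps each factor short. *)
Lemma fraction_bound x : exists u v,
  x = (phi u)^-1 * phi v /\ (len u + len v <= (n - 1) * ell1 x)%N.
Proof.
have [w0 w0E] := group_gen_surj x.
have [w wE xE] := word_length_word (@artin_gen n.+1) w0.
rewrite /Defs.ell1 w0E -wE xE => {x w0 w0E wE xE}.
suff [u [v [k [p [-> up pv kp]]]]] : exists u v k p,
    [/\ signed_prod (@artin_gen n.+1) w = (phi u)^-1 * phi v,
      (len u <= (n - 1) * k)%N, short_product p v & (k + p = size w)%N].
  exists u, v; split => //; have := short_product_len pv; rewrite -kp mulnDr;
    lia.
elim/last_ind: w => [|w [i b] [u [v [k [p [E uk vp kp]]]]]].
  by exists 1, 1, 0%N, 0%N; rewrite /signed_prod big_nil bkl_braid1 invg1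
    mulg1 len1.
rewrite -cats1 signed_prod_cat E /signed_prod big_seq1 artin_gen_bkl size_cat
  /= addn1.
case: b => /=.
  have [r' [v' [[lr' _] Pv' E']]] :=
    short_product_swap vp (short_divisor_gen (artin_bkl i)).
  exists (r' * u), v', k.+1, p; split => //; last by rewrite addSn kp.
    apply: (@mulgI _ (phi (r' * u)));
      rewrite mulVKg bkl_braidM -!mulgA mulVKg mulgA.
    by rewrite -bkl_braidM E' bkl_braidM mulgK.
  by rewrite lenM mulnS; lia.
exists u, (v * gen (artin_bkl i)), k, p.+1; split => //.
- by rewrite bkl_braidM mulgA.
- by exists v, (gen (artin_bkl i)); split => //; apply: short_divisor_gen.
- by rewrite addnS kp.
Qed.

(** * The two bounds *)

Lemma ell2R_upper x : (ell2R x <= (n - 1) * ell1 x)%N.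
Proof.
have [u0 [v0 [E0 le0]]] := fraction_bound x.
have [|u [v [ss [pp [E uv us vp ->]]]]] := @ell2RP x; first by exists u0, v0.
have [|f [uE vE]] := @reduced_fraction_ldiv u v u0 v0 uv; first by rewrite -E.
apply: leq_trans le0; rewrite uE vE !lenM (greedy_nf_len us) (greedy_nf_len vp).
have H s : (\sum_(t <- s) ell2 (phi t) <= \sum_(t <- s) len t)%N.
  by apply: leq_sum => t _; apply: ell2_le_len.
by have := H ss; have := H pp; lia.
Qed.

Lemma ell2R_lower x : (ell1 x <= (2 * n.+1 - 3) * ell2R x)%N.
Proof.
have [u0 [v0 [E0 _]]] := fraction_bound x.
have [|u [v [ss [pp [-> uv us vp ->]]]]] := @ell2RP x; first by exists u0, v0.
have H s : (ell1 (phi (\prod_(t <- s) t)%g) <=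
    (2 * n.+1 - 3) * \sum_(t <- s) ell2 (phi t))%N.
  rewrite bkl_braid_prod; apply: leq_trans (ell1_prod _ _) _.
  by rewrite big_distrr; apply: leq_sum => t _; apply: ell1_le_ell2.
rewrite (greedy_nf_prod us) (greedy_nf_prod vp) mulnDr.
apply: leq_trans (ell1M _ _) _; apply: leq_add; last exact: H.
exact: leq_trans (ell1V _) (H ss).
Qed.
End Comparison.

Theorem corollary22 (N : nat) (hN : (3 <= N)%N) (x : braid N) :
  ((2 * N%:R - 3)^-1 * (ell1 x)%:R <= (ell2R x)%:R :> rat)%R /\
  ((ell2R x)%:R <= (N%:R - 2) * (ell1 x)%:R :> rat)%R.
Proof.
case: N hN x => // n hn x; have n2 : (2 <= n)%N by [].
have low := ell2R_lower n2 x; have up := ell2R_upper n2 x.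
have e1 : (2 * n.+1%:R - 3 = (2 * n.+1 - 3)%:R :> rat)%R.
  by rewrite natrB ?natrM //; lia.
have e2 : (n.+1%:R - 2 = (n - 1)%:R :> rat)%R.
  have -> : (n - 1 = n.+1 - 2)%N by lia.
  by rewrite natrB //; lia.
split.
  rewrite e1 ler_pdivrMl ?ltr0n; last lia.
  by rewrite -natrM ler_nat.
by rewrite e2 -natrM ler_nat.
Qed.
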